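(* Suppose the objectives satisfy (F), the noise satisfies (N) and the coupling matrix satisfies (W) as described in the context, and run the algorithm of the context (i.e. with $\gamma_k=1$ and $\beta_k=1$ for all $k$) with a stepsize $\alpha>0$ satisfying $$\alpha<\min\left\{\frac1{\mu+L},\ \frac{1-\rho_w^2}{4\sqrt2\,d_IL},\ \sqrt{\frac{2d_3}{d_2+\sqrt{d_2^2+4d_1d_3}}}\right\},$$ where $d_1=\frac{128L^6d_I^2}{\mu(1-\rho_w^2)^2}$, $d_2=8\mu L^2d_I^2+\frac{128\mu d_I^2L^2}{(1-\rho_w^2)^2}$, $d_3=\frac{\mu(1-\rho_w^2)^2}{4}$. Let $$A=\begin{bmatrix}1-\alpha\mu&\frac{2\alpha L^2}{\mu n}&0\\[1mm]0&\frac{1+\rho_w^2}2&\frac{2\alpha^2}{1-\rho_w^2}\\[1mm]\frac{32n\alpha^2L^4d_I^2}{1-\rho_w^2}&\frac{64d_I^2L^2}{1-\rho_w^2}&\frac{1+\rho_w^2}2+\frac{16\alpha^2L^2d_I^2}{1-\rho_w^2}\end{bmatrix},\qquad B=\begin{bmatrix}\alpha^2\sigma_\eta^2+\sigma_\xi^2\\[1mm]nd_I^2\sigma_\xi^2\\[1mm]\frac{24nd_I^2}{1-\rho_w^2}\sigma_\eta^2+\frac{4nL^2d_I^2}{1-\rho_w^2}\sigma_\xi^2\end{bmatrix}\rho(W_o)^2,$$ and let $\theta_1,\theta_2$ be the first and second entries of $(I-A)^{-1}B$. Then the algorithm converges at a linear rate $\mathcal{O}(\rho(A)^k)$; that is,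 $\rho(A)<1$ and there is a constant $c$ independent of $k$ with $\mathbb{E}[\|\bar x_k-x^\ast\|_2^2]\le\theta_1+c\,\rho(A)^k$ and $\mathbb{E}[\|\boldsymbol{x}_k-\boldsymbol{1}\bar x_k\|_2^2]\le\theta_2+c\,\rho(A)^k$ for all $k\ge0$. Moreover, $$\limsup_{k\to\infty}\mathbb{E}[\|\bar x_k-x^\ast\|_2^2]\le\theta_1,\qquad \limsup_{k\to\infty}\mathbb{E}[\|\boldsymbol{x}_k-\boldsymbol{1}\bar x_k\|_2^2]\le\theta_2.$$
   Context: Setting: $n\ge 2$ agents, agent $i$ holding a differentiable local objective $f_i:\mathbb{R}^r\to\mathbb{R}$; the goal is to minimize $f=\frac1n\sum_{i=1}^n f_i$. (F) Each $f_i$ is $\mu$-strongly convex with $L$-Lipschitz gradient ($\mu,L>0$): for all $x,x'\in\mathbb{R}^r$, $\langle\nabla f_i(x)-\nabla f_i(x'),x-x'\rangle\ge\mu\|x-x'\|_2^2$ and $\|\nabla f_i(x)-\nabla f_i(x')\|_2\le L\|x-x'\|_2$. Then $f$ has a unique minimizer $x^\ast$. (W) $W=[w_{ij}]\in\mathbb{R}^{n\times n}$ is entrywise nonnegative, symmetric and doubly stochastic, $w_{ii}>0$ for all $i$, and the undirected graph on $\{1,\dots,n\}$ with an edge $\{i,j\}$ whenever $w_{ij}>0$ is connected. $W_o$ is $W$ with all diagonal entries replaced by $0$. (N) Random matrices $\boldsymbol\eta_k,\boldsymbol\xi_k\in\mathbb{R}^{n\times r}$, $k\ge0$: all their scalar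 entries (over iterations $k$, agents $i$, coordinates $j$) are mutually independent, with $\mathbb{E}[\boldsymbol\eta_k]=\mathbb{E}[\boldsymbol\xi_k]=0$, $\mathbb{E}[\|\boldsymbol\eta_k\|_2^2]\le\sigma_\eta^2$, $\mathbb{E}[\|\boldsymbol\xi_k\|_2^2]\le\sigma_\xi^2$ for some $\sigma_\eta,\sigma_\xi>0$. Algorithm (with $\gamma_k=\beta_k=1$): from arbitrary (deterministic) $\boldsymbol{s}_0,\boldsymbol{x}_0\in\mathbb{R}^{n\times r}$ (row $i$ belongs to agent $i$), for $k\ge0$, $$\boldsymbol{s}_{k+1}=W\boldsymbol{s}_k+W_o\boldsymbol\eta_k+\nabla F(\boldsymbol{x}_k),\qquad \boldsymbol{x}_{k+1}=W\boldsymbol{x}_k+W_o\boldsymbol\xi_k-\alpha(\boldsymbol{s}_{k+1}-\boldsymbol{s}_k),$$ where $\nabla F(\boldsymbol{x})\in\mathbb{R}^{n\times r}$ has $i$-th row $\nabla f_i(x_i)^T$, with $x_i^T$ the $i$-th row of $\boldsymbol{x}$. Notation: $\boldsymbol{1}\in\mathbb{R}^n$ is the all-ones vector; $\bar x_k=\frac1n\boldsymbol{1}^T\boldsymbol{x}_k$ (a row vector; $x^\ast$ is identified with a row vector when needed). For matrices, $\|\cdot\|_2$ denotes the Euclidean norm of the vector of columnwise Euclidean norms, i.e. the Frobenius norm. $d_I^2=\|I-\frac{\boldsymbol{1}\boldsymbol{1}^T}{n}\|_2^2$ (so $d_I^2=n-1$), $d_I\ge0$; $\rho(\cdot)$ is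 the spectral radius; $\rho_w=\rho(W-\frac{\boldsymbol{1}\boldsymbol{1}^T}{n})$, which is $<1$ under (W). *)

(* Defs.v *)
From HB Require Import structures.
From mathcomp Require Import all_boot all_order all_algebra.
From mathcomp Require Import complex.
From mathcomp Require Import all_classical all_reals all_analysis.

Set Implicit Arguments.
Unset Strict Implicit.
Unset Printing Implicit Defensive.

Import Order.TTheory GRing.Theory Num.Theory.
Import numFieldNormedType.Exports.

Local Open Scope classical_set_scope.
Local Open Scope ring_scope.

Section LinearAlgebra.
Context {R : realType}.

(* The norm canonically attached to 'M[R]_(m, n) is the sup norm, hence this
   separate Frobenius norm; on row vectors it is the Euclidean norm. *)
Definition norm2 {m n} (A : 'M[R]_(m, n)) : R :=
  Num.sqrt (\sum_i \sum_j A i j ^+ 2).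

Definition dotrv {n} (x y : 'rV[R]_n) : R := \sum_j x 0 j * y 0 j.

(* Maximum modulus of the complex eigenvalues; for n > 0 their set is finite
   and nonempty, so the supremum is attained. *)
Definition spectral_radius {n} (A : 'M[R]_n) : R :=
  sup [set Normc.normc z | z in [set z : R[i] | eigenvalue (map_mx (real_complex R) A) z]].

Definition ones {n} : 'cV[R]_n := const_mx 1.

Definition row_mean {n r} (x : 'M[R]_(n, r)) : 'rV[R]_r :=
  n%:R^-1 *: (ones^T *m x).

Definition averaging_mx {n} : 'M[R]_n := n%:R^-1 *: (ones *m ones^T).

Definition off_diag {n} (W : 'M[R]_n) : 'M[R]_n :=
  \matrix_(i, j) if i == j then 0 else W i j.

Definition mx_of_rows {m n} (rows : seq (seq R)) : 'M[R]_(m, n) :=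
  \matrix_(i, j) (nth [::] rows i)`_j.

End LinearAlgebra.

Section Objectives.
Context {R : realType}.

Definition grad {r} (f : 'rV[R]_r -> R) (x : 'rV[R]_r) : 'rV[R]_r :=
  \row_j 'D_(delta_mx 0 j) f x.

Definition strongly_convex_smooth {r} (mu L : R) (f : 'rV[R]_r -> R) : Prop :=
  [/\ forall x, differentiable f x,
      forall x y, dotrv (grad f x - grad f y) (x - y) >= mu * norm2 (x - y) ^+ 2
    & forall x y, norm2 (grad f x - grad f y) <= L * norm2 (x - y)].

Definition mean_objective {n r} (f : 'I_n -> 'rV[R]_r -> R) (x : 'rV[R]_r) : R :=
  n%:R^-1 * \sum_i f i x.

Definition is_minimizer {r} (f : 'rV[R]_r -> R) (x : 'rV[R]_r) : Prop :=
  forall y, f x <= f y.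

Definition stacked_grad {n r} (f : 'I_n -> 'rV[R]_r -> R) (x : 'M[R]_(n, r)) :
    'M[R]_(n, r) :=
  \matrix_(i, j) grad (f i) (row i x) 0 j.

End Objectives.

Section Coupling.
Context {R : realType}.

Definition coupling_mx {n} (W : 'M[R]_n) : Prop :=
  [/\ forall i j, 0 <= W i j,
      W^T = W,
      (forall i, \sum_j W i j = 1) /\ (forall j, \sum_i W i j = 1),
      forall i, 0 < W i i
    & forall i j, connect [rel a b | 0 < W a b] i j].

Definition rho_w {n} (W : 'M[R]_n) : R := spectral_radius (W - averaging_mx).

Definition d_I (n : nat) : R := norm2 (1%:M - averaging_mx : 'M[R]_n).

End Coupling.

Section Noise.
Context {d : measure_display} {T : measurableType d} {R : realType}.
Variable P : probability T R.

(* The product rule over all finite subfamilies. *)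
Definition mutually_independent {I : eqType} (X : I -> {RV P >-> R}) : Prop :=
  forall (J : seq I) (B : I -> set R),
    uniq J -> (forall i, measurable (B i)) ->
    P (\bigcap_(i in [set` J]) (X i @^-1` B i)) =
    (\prod_(i <- J) fine (P (X i @^-1` B i)))%:E.

Definition noise_mx {n r} (eta : nat -> 'I_n -> 'I_r -> {RV P >-> R})
    (k : nat) (w : T) : 'M[R]_(n, r) :=
  \matrix_(i, j) eta k i j w.

(* The boolean selects between the two noise sequences, so that independence is
   required of all the entries of both sequences jointly. *)
Definition joint_entries {n r} (eta xi : nat -> 'I_n -> 'I_r -> {RV P >-> R})
    (q : bool * nat * 'I_n * 'I_r) : {RV P >-> R} :=
  let: (b, k, i, j) := q in if b then xi k i j else eta k i j.

Definition noise_model {n r} (sigma_eta sigma_xi : R)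
    (eta xi : nat -> 'I_n -> 'I_r -> {RV P >-> R}) : Prop :=
  [/\ mutually_independent (joint_entries eta xi),
      forall k i j, ('E_P[eta k i j] = 0)%E /\ ('E_P[xi k i j] = 0)%E,
      forall k, ('E_P[fun w => (norm2 (noise_mx eta k w) ^+ 2)%R]
                 <= (sigma_eta ^+ 2)%:E)%E
    & forall k, ('E_P[fun w => (norm2 (noise_mx xi k w) ^+ 2)%R]
                 <= (sigma_xi ^+ 2)%:E)%E].

End Noise.

Section Algorithm.
Context {R : realType}.

(* The pair (s_k, x_k) along fixed noise realizations. *)
Fixpoint iterates {n r} (f : 'I_n -> 'rV[R]_r -> R) (W : 'M[R]_n) (alpha : R)
    (s0 x0 : 'M[R]_(n, r)) (eta xi : nat -> 'M[R]_(n, r)) (k : nat) :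
    'M[R]_(n, r) * 'M[R]_(n, r) :=
  if k is k'.+1 then
    let: (s, x) := iterates f W alpha s0 x0 eta xi k' in
    let s' := W *m s + off_diag W *m eta k' + stacked_grad f x in
    let x' := W *m x + off_diag W *m xi k' - alpha *: (s' - s) in
    (s', x')
  else (s0, x0).

End Algorithm.

Section Rates.
Context {R : realType}.
Variables (n : nat) (mu L dI rw : R).

Definition d_1 : R := 128%:R * L ^+ 6 * dI ^+ 2 / (mu * (1 - rw ^+ 2) ^+ 2).
Definition d_2 : R := 8%:R * mu * L ^+ 2 * dI ^+ 2
  + 128%:R * mu * dI ^+ 2 * L ^+ 2 / (1 - rw ^+ 2) ^+ 2.
Definition d_3 : R := mu * (1 - rw ^+ 2) ^+ 2 / 4%:R.

Definition stepsize_bound : R :=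
  Num.min (1 / (mu + L))
    (Num.min ((1 - rw ^+ 2) / (4%:R * Num.sqrt 2%:R * dI * L))
       (Num.sqrt (2%:R * d_3 / (d_2 + Num.sqrt (d_2 ^+ 2 + 4%:R * d_1 * d_3))))).

Definition rate_mx (alpha : R) : 'M[R]_3 := mx_of_rows
  [:: [:: 1 - alpha * mu; 2%:R * alpha * L ^+ 2 / (mu * n%:R); 0];
      [:: 0; (1 + rw ^+ 2) / 2%:R; 2%:R * alpha ^+ 2 / (1 - rw ^+ 2)];
      [:: 32%:R * n%:R * alpha ^+ 2 * L ^+ 4 * dI ^+ 2 / (1 - rw ^+ 2);
          64%:R * dI ^+ 2 * L ^+ 2 / (1 - rw ^+ 2);
          (1 + rw ^+ 2) / 2%:R
          + 16%:R * alpha ^+ 2 * L ^+ 2 * dI ^+ 2 / (1 - rw ^+ 2)]].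

Definition noise_vec (alpha sigma_eta sigma_xi rho_o : R) : 'cV[R]_3 :=
  rho_o ^+ 2 *: mx_of_rows
  [:: [:: alpha ^+ 2 * sigma_eta ^+ 2 + sigma_xi ^+ 2];
      [:: n%:R * dI ^+ 2 * sigma_xi ^+ 2];
      [:: 24%:R * n%:R * dI ^+ 2 / (1 - rw ^+ 2) * sigma_eta ^+ 2
          + 4%:R * n%:R * L ^+ 2 * dI ^+ 2 / (1 - rw ^+ 2) * sigma_xi ^+ 2]].

End Rates.

(* Main.v *)
Require Import Defs.
From HB Require Import structures.
From mathcomp Require Import all_boot all_order all_algebra.
From mathcomp Require Import complex.
From mathcomp Require Import all_classical all_reals all_analysis.
From mathcomp Require Import measurable_realfun.
From mathcomp Require Import ring lra.

(** The averaged error, the consensus error and the tracking error obey, in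
    expectation, a linear system with the matrix A and the constant term B.

    Write y_k = s_{k+1} - s_k for the increment of the tracker, so that
    x_{k+1} = W x_k + W_o xi_k - alpha y_k and
    y_{k+1} = W y_k + W_o (eta_{k+1} - eta_k) + grad F (x_{k+1}) - grad F (x_k).
    Let u_k, v_k and z_k be the expectations of the squared norms of
    mean x_k - x*, of x_k minus its mean and of y_k minus its mean. Three one-step
    bounds hold along every noise realization.
    - The mean of x performs a gradient step on f, up to noise and up to the
      difference between the average of the local gradients and the gradient at
      the average, which the Lipschitz constant L and the consensus error control
      ([optimality_step]). The exact step contracts thanks to cocoercivity of the
      gradient ([grad_cocoercive], [gradient_step_contracts]).
    - On deviations from the mean, mixing acts as W minus the averaging matrix, a
      symmetric matrix, so it contracts by its spectral radius
      ([sqr_norm2_sym_mul], [mixing_young]); this gives [consensus_step].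
    - The tracker is mixed in the same way and driven by the variation of the
      gradients, which is controlled by x_{k+1} - x_k ([tracking_step]).

    These bounds still contain inner products of a fresh noise with quantities
    computed before that noise is drawn. Such quantities are measurable with
    respect to the sigma-algebra of all the other noise entries, which is
    independent of each entry of the fresh noise by Dynkin's theorem, so the
    inner products have zero expectation ([expectation_mul_independent],
    [cross_term_eq0]). Measurability and square-integrability of the iterates
    only use that the gradients are Lipschitz ([entries_iterates]).

    With U_k = (u_k, v_k, z_k) this yields U_{k+1} <= A U_k + B entrywise
    ([error_vec_step]). The nonnegative matrix A has a positive eigenvector for
    its spectral radius, which is smaller than 1 thanks to the third stepsize
    bound ([cyclic_perron], [rate_mx_perron]). Comparing U_k - theta,
    where theta = (I - A)^{-1} B is the fixed point, with a multiple of that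
    eigenvector gives U_k <= theta + c rho(A)^k v for some c
    ([positive_recursion]), and the bounds on the limits superior follow. *)

Set Implicit Arguments.
Unset Strict Implicit.
Unset Printing Implicit Defensive.

Import Order.TTheory GRing.Theory Num.Theory.
Import numFieldNormedType.Exports.

Local Open Scope classical_set_scope.
Local Open Scope ring_scope.

(** * The Frobenius inner product *)
Section FrobeniusNorm.
Context {R : realType}.

Definition mxdot {m n} (A B : 'M[R]_(m, n)) : R := \sum_i \sum_j A i j * B i j.

Lemma sqr_norm2E {m n} (A : 'M[R]_(m, n)) :
  norm2 A ^+ 2 = \sum_i \sum_j A i j ^+ 2.
Proof.
by rewrite sqr_sqrtr// sumr_ge0// => i _; rewrite sumr_ge0// => j _;
  exact: sqr_ge0.
Qed.

Lemma norm2_ge0 {m n} (A : 'M[R]_(m, n)) : 0 <= norm2 A.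
Proof. exact: sqrtr_ge0. Qed.

Lemma mxdot_sqr {m n} (A : 'M[R]_(m, n)) : mxdot A A = norm2 A ^+ 2.
Proof. by rewrite sqr_norm2E. Qed.

Lemma dotrvE {n} (x y : 'rV[R]_n) : dotrv x y = mxdot x y.
Proof. by rewrite /mxdot big_ord1. Qed.

Lemma mxdotC {m n} (A B : 'M[R]_(m, n)) : mxdot A B = mxdot B A.
Proof. by do 2!apply: eq_bigr => ? _; rewrite mulrC. Qed.

Lemma mxdotDl {m n} (A B C : 'M[R]_(m, n)) :
  mxdot (A + B) C = mxdot A C + mxdot B C.
Proof.
rewrite -big_split; apply: eq_bigr => i _; rewrite -big_split.
by apply: eq_bigr => j _; rewrite mxE mulrDl.
Qed.

Lemma mxdotZl {m n} (a : R) (A B : 'M[R]_(m, n)) :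
  mxdot (a *: A) B = a * mxdot A B.
Proof.
rewrite mulr_sumr; apply: eq_bigr => i _; rewrite mulr_sumr.
by apply: eq_bigr => j _; rewrite mxE mulrA.
Qed.

Lemma mxdotNl {m n} (A B : 'M[R]_(m, n)) : mxdot (- A) B = - mxdot A B.
Proof. by rewrite -scaleN1r mxdotZl mulN1r. Qed.

Lemma mxdot0l {m n} (A : 'M[R]_(m, n)) : mxdot 0 A = 0.
Proof. by rewrite -(scale0r (0 : 'M[R]_(m, n))) mxdotZl mul0r. Qed.

Lemma mxdotBl {m n} (A B C : 'M[R]_(m, n)) :
  mxdot (A - B) C = mxdot A C - mxdot B C.
Proof. by rewrite mxdotDl mxdotNl. Qed.

Lemma mxdotDr {m n} (A B C : 'M[R]_(m, n)) :
  mxdot C (A + B) = mxdot C A + mxdot C B.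
Proof. by rewrite !(mxdotC C) mxdotDl. Qed.

Lemma mxdotZr {m n} (a : R) (A B : 'M[R]_(m, n)) :
  mxdot B (a *: A) = a * mxdot B A.
Proof. by rewrite !(mxdotC B) mxdotZl. Qed.

Lemma mxdotNr {m n} (A B : 'M[R]_(m, n)) : mxdot A (- B) = - mxdot A B.
Proof. by rewrite mxdotC mxdotNl mxdotC. Qed.

Lemma mxdotBr {m n} (A B C : 'M[R]_(m, n)) :
  mxdot C (A - B) = mxdot C A - mxdot C B.
Proof. by rewrite mxdotDr mxdotNr. Qed.

Lemma sqr_norm2D {m n} (A B : 'M[R]_(m, n)) :
  norm2 (A + B) ^+ 2 = norm2 A ^+ 2 + 2 * mxdot A B + norm2 B ^+ 2.
Proof.
rewrite -!mxdot_sqr !mxdotDl !mxdotDr (mxdotC B A); ring.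
Qed.

Lemma sqr_norm2Z {m n} (a : R) (A : 'M[R]_(m, n)) :
  norm2 (a *: A) ^+ 2 = a ^+ 2 * norm2 A ^+ 2.
Proof. by rewrite -!mxdot_sqr mxdotZl mxdotZr; ring. Qed.

Lemma sqr_norm2N {m n} (A : 'M[R]_(m, n)) : norm2 (- A) ^+ 2 = norm2 A ^+ 2.
Proof. by rewrite -scaleN1r sqr_norm2Z sqrrN expr1n mul1r. Qed.

Lemma sqr_norm2B {m n} (A B : 'M[R]_(m, n)) :
  norm2 (A - B) ^+ 2 = norm2 A ^+ 2 - 2 * mxdot A B + norm2 B ^+ 2.
Proof. by rewrite sqr_norm2D sqr_norm2N mxdotNr; ring. Qed.

(** Completing the square in c A - B; working with a pair of weights c, e with
    1 <= c e rather than with c and 1/c avoids any case distinction when the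
    weight degenerates. *)
Lemma mxdot_young {m n} (c e : R) (A B : 'M[R]_(m, n)) : 0 < c -> 1 <= c * e ->
  2 * mxdot A B <= c * norm2 A ^+ 2 + e * norm2 B ^+ 2.
Proof.
move=> c0 ce; have := sqr_ge0 (norm2 (c *: A - B)).
have B0 := sqr_ge0 (norm2 B).
rewrite sqr_norm2B sqr_norm2Z mxdotZl => h.
rewrite -(ler_pM2l c0).
have : 0 <= (c * e - 1) * norm2 B ^+ 2 by rewrite mulr_ge0// subr_ge0.
by move: h; lra.
Qed.

Lemma sqr_norm2D_young {m n} (c e : R) (A B : 'M[R]_(m, n)) :
  0 < c -> 1 <= c * e ->
  norm2 (A + B) ^+ 2 <= (1 + c) * norm2 A ^+ 2 + (1 + e) * norm2 B ^+ 2.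
Proof.
by move=> c0 ce; have := mxdot_young A B c0 ce; rewrite sqr_norm2D; lra.
Qed.

Lemma sqr_norm2D_le {m n} (A B : 'M[R]_(m, n)) :
  norm2 (A + B) ^+ 2 <= 2 * norm2 A ^+ 2 + 2 * norm2 B ^+ 2.
Proof.
by have := @sqr_norm2D_young _ _ 1 1 A B ltr01; rewrite mulr1 => /(_ (lexx _)).
Qed.

Lemma sqr_norm2B_le {m n} (A B : 'M[R]_(m, n)) :
  norm2 (A - B) ^+ 2 <= 2 * norm2 A ^+ 2 + 2 * norm2 B ^+ 2.
Proof. by rewrite -(sqr_norm2N B) sqr_norm2D_le. Qed.

Lemma sqr_norm2_row {m n} (A : 'M[R]_(m, n)) :
  norm2 A ^+ 2 = \sum_i norm2 (row i A) ^+ 2.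
Proof.
rewrite sqr_norm2E; apply: eq_bigr => i _; rewrite sqr_norm2E big_ord1.
by apply: eq_bigr => j _; rewrite mxE.
Qed.

Lemma sqr_entry_le {m n} (A : 'M[R]_(m, n)) i j : A i j ^+ 2 <= norm2 A ^+ 2.
Proof.
rewrite sqr_norm2E (bigD1 i)//= (bigD1 j)//= -addrA lerDl addr_ge0//.
  by apply: sumr_ge0 => k _; exact: sqr_ge0.
by apply: sumr_ge0 => k _; apply: sumr_ge0 => l _; exact: sqr_ge0.
Qed.

End FrobeniusNorm.

(** * Spectral radius and operator norm *)
Section SpectralRadius.
Context {R : realType}.
Notation C := (R[i]).
Notation toC := (real_complex R).

Lemma normr_normc (z : C) : `|z| = (Normc.normc z)%:C%C.
Proof. by rewrite normc_def; case: z. Qed.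

Lemma normc_ge0 (z : C) : 0 <= Normc.normc z.
Proof. by case: z => a b; exact: sqrtr_ge0. Qed.

(** Weighted form of the row-sum bound on eigenvalues: pair the entrywise moduli
    of a left eigenvector with the positive vector v. With v constant it shows
    that the moduli of the eigenvalues are bounded, so that the supremum in the
    definition of the spectral radius is meaningful; with v a positive
    eigenvector it is the Perron-Frobenius upper bound. *)
Lemma eigenvalue_le_weighted {n} (A : 'M[R]_n) (v : 'I_n -> R) (l : R) (z : C) :
  (forall j, 0 < v j) -> (forall i, \sum_j `|A i j| * v j <= l * v i) ->
  eigenvalue (map_mx toC A) z -> Normc.normc z <= l.
Proof.
move=> v0 Av /eigenvalueP[u uA u0].
pose a i := Normc.normc (u 0 i).
have a0 i : 0 <= a i by exact: normc_ge0.
have [k ak] : exists k, 0 < a k.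
  move/rV0Pn: u0 => [k uk]; exists k; rewrite lt0r a0 andbT.
  by apply: contra uk => /eqP/Normc.eq0_normc ->.
have S0 : 0 < \sum_j a j * v j.
  rewrite (bigD1 k)//= ltr_wpDr ?mulr_gt0//.
  by apply: sumr_ge0 => j _; rewrite mulr_ge0// ltW.
have key j : Normc.normc z * a j <= \sum_i a i * `|A i j|.
  rewrite -lecR rmorphM/= -!normr_normc -normrM.
  have -> : z * u 0 j = \sum_i u 0 i * (A i j)%:C%C.
    move/rowP: uA => /(_ j); rewrite !mxE => <-.
    by apply: eq_bigr => i _; rewrite mxE.
  rewrite (le_trans (ler_norm_sum _ _ _))// rmorph_sum ler_sum// => i _.
  rewrite normrM rmorphM/= -normr_normc ler_wpM2l//.
  by rewrite normc_def/= expr0n/= addr0 sqrtr_sqr.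
rewrite -(ler_pM2r S0) mulr_sumr.
apply: (@le_trans _ _ (\sum_j (\sum_i a i * `|A i j|) * v j)).
  by apply: ler_sum => j _; rewrite mulrA ler_wpM2r// ltW.
under eq_bigr do rewrite mulr_suml.
rewrite exchange_big/= mulr_sumr ler_sum// => i _.
under eq_bigr do rewrite -mulrA.
by rewrite -mulr_sumr mulrCA ler_wpM2l.
Qed.

Lemma spectral_set_ubound {n} (A : 'M[R]_n) :
  has_ubound [set Normc.normc z | z in
    [set z : C | eigenvalue (map_mx toC A) z]].
Proof.
exists (\sum_i \sum_j `|A i j|) => _ [z + <-] /=.
apply: (@eigenvalue_le_weighted _ _ (fun=> 1)) => // i.
rewrite /= mulr1; under eq_bigr do rewrite mulr1.
rewrite [leRHS](bigD1 i)//= lerDl sumr_ge0// => k _.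
by rewrite sumr_ge0.
Qed.

Lemma normc_le_spectral_radius {n} (A : 'M[R]_n) (z : C) :
  eigenvalue (map_mx toC A) z -> Normc.normc z <= spectral_radius A.
Proof.
by move=> ez; apply: ub_le_sup; [exact: spectral_set_ubound | exists z].
Qed.

Lemma spectral_radius_ge0 {n} (A : 'M[R]_n) :
  (0 < n)%N -> 0 <= spectral_radius A.
Proof.
move=> n0; have [z ez] := eigenvalue_closed (map_mx toC A) n0.
exact: le_trans (normc_ge0 z) (normc_le_spectral_radius ez).
Qed.

Lemma spectral_radius_le {n} (A : 'M[R]_n) (l : R) : (0 < n)%N ->
  (forall z, eigenvalue (map_mx toC A) z -> Normc.normc z <= l) ->
  spectral_radius A <= l.
Proof.
move=> n0 h; apply: ge_sup; last by move=> _ [z + <-]; exact: h.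
have [z ez] := eigenvalue_closed (map_mx toC A) n0.
by exists (Normc.normc z), z.
Qed.

(** Squared Frobenius norm over the complex numbers, the field over which
    symmetric matrices are diagonalized by a unitary matrix. *)
Definition csqr {m n} (M : 'M[C]_(m, n)) : C := \sum_i \sum_j `|M i j| ^+ 2.

Local Open Scope sesquilinear_scope.

Lemma csqr_tr {m n} (M : 'M[C]_(m, n)) : csqr M = \tr (M *m M^t*).
Proof.
apply: eq_bigr => i _; rewrite mxE; apply: eq_bigr => j _.
by rewrite !mxE normCK.
Qed.

Lemma csqr_unitary {m n} (U : 'M[C]_m) (M : 'M[C]_(m, n)) :
  U \is unitarymx -> csqr (U *m M) = csqr M.
Proof.
move=> Uu; rewrite !csqr_tr trmx_mul map_mxM/= mulmxA mxtrace_mulC.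
by rewrite -(invmx_unitary Uu) !mulmxA mulVmx ?mul1mx// unitarymx_unit.
Qed.

Lemma csqr_diag {m n} (d : 'rV[C]_m) (M : 'M[C]_(m, n)) (l : R) :
  0 <= l -> (forall i, Normc.normc (d 0 i) <= l) ->
  csqr (diag_mx d *m M) <= (l ^+ 2)%:C%C * csqr M.
Proof.
move=> l0 dl; rewrite mulr_sumr ler_sum// => i _.
rewrite mulr_sumr ler_sum// => j _.
rewrite mul_diag_mx mxE normrM exprMn ler_wpM2r ?exprn_ge0//.
rewrite normr_normc -!rmorphXn/= lecR.
by apply: lerXn2r; rewrite ?nnegrE ?normc_ge0.
Qed.

Lemma csqr_real {m n} (A : 'M[R]_(m, n)) :
  csqr (map_mx toC A) = (norm2 A ^+ 2)%:C%C.
Proof.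
rewrite sqr_norm2E rmorph_sum; apply: eq_bigr => i _.
rewrite rmorph_sum; apply: eq_bigr => j _.
by rewrite mxE normc_def/= expr0n/= addr0 sqrtr_sqr -rmorphXn/= real_normK// num_real.
Qed.

(** For a real symmetric matrix the spectral radius is the operator norm: in a
    unitary basis of eigenvectors, which preserves the Frobenius norm, the matrix
    multiplies every row by an eigenvalue. *)
Lemma sqr_norm2_sym_mul {n r} (A : 'M[R]_n) (X : 'M[R]_(n, r)) :
  (0 < n)%N -> A^T = A ->
  norm2 (A *m X) ^+ 2 <= spectral_radius A ^+ 2 * norm2 X ^+ 2.
Proof.
move=> n0 symA; pose AC := map_mx toC A.
have /orthomx_spectralP AE : AC \is normalmx.
  apply/hermitian_normalmx/is_hermitianmxP.
  rewrite expr0 scale1r; apply/matrixP => i j; rewrite !mxE.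
  have -> : A j i = A i j by rewrite -[in LHS]symA mxE.
  by apply/esym/CrealP; rewrite realE !lecR -realE num_real.
set U := spectralmx AC in AE; set d := spectral_diag AC in AE.
have Uu : U \is unitarymx by exact: spectral_unitarymx.
have Ui : U \in unitmx by exact: unitarymx_unit.
have dle i : Normc.normc (d 0 i) <= spectral_radius A.
  apply: normc_le_spectral_radius; apply/eigenvalueP; exists (row i U).
    rewrite -/AC AE -row_mul !mulmxA mulmxV// mul1mx.
    by apply/rowP => j; rewrite mxE mul_diag_mx !mxE.
  apply/eqP => Ui0; have := oner_neq0 C; case/eqP.
  have := row_mul i U (invmx U); rewrite Ui0 mul0mx mulmxV// => /rowP/(_ i).
  by rewrite !mxE eqxx.
have : csqr (AC *m map_mx toC X) <=
    (spectral_radius A ^+ 2)%:C%C * csqr (map_mx toC X).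
  rewrite AE -!mulmxA invmx_unitary// csqr_unitary ?trmxC_unitary//.
  by rewrite -[X in _ <= _ * X](csqr_unitary _ Uu) csqr_diag// spectral_radius_ge0.
by rewrite -map_mxM !csqr_real -rmorphM lecR.
Qed.

End SpectralRadius.

(** * Averages and deviations under a doubly stochastic matrix *)
Section Averaging.
Context {R : realType} {n : nat} (n_gt0 : (0 < n)%N).
Notation mean := (@row_mean R n _).
Notation avg := (@averaging_mx R n).

(** The orthogonal projection onto the complement of the consensus matrices, those
    with all rows equal. *)
Definition deviation {r} (X : 'M[R]_(n, r)) : 'M[R]_(n, r) :=
  X - ones *m row_mean X.

Let n_neq0 : n%:R != 0 :> R.
Proof. by rewrite pnatr_eq0 -lt0n. Qed.

Lemma row_meanE {r} (X : 'M[R]_(n, r)) j :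
  row_mean X 0 j = n%:R^-1 * \sum_i X i j.
Proof.
by rewrite !mxE; congr (_ * _); apply: eq_bigr => i _; rewrite !mxE mul1r.
Qed.

Lemma row_meanD {r} (X Y : 'M[R]_(n, r)) :
  row_mean (X + Y) = row_mean X + row_mean Y.
Proof. by rewrite /row_mean mulmxDr scalerDr. Qed.

Lemma row_meanZ {r} (a : R) (X : 'M[R]_(n, r)) :
  row_mean (a *: X) = a *: row_mean X.
Proof. by rewrite /row_mean -scalemxAr !scalerA mulrC. Qed.

Lemma row_meanN {r} (X : 'M[R]_(n, r)) : row_mean (- X) = - row_mean X.
Proof. by rewrite -scaleN1r row_meanZ scaleN1r. Qed.

Lemma row_meanB {r} (X Y : 'M[R]_(n, r)) :
  row_mean (X - Y) = row_mean X - row_mean Y.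
Proof. by rewrite row_meanD row_meanN. Qed.

Lemma deviationD {r} (X Y : 'M[R]_(n, r)) :
  deviation (X + Y) = deviation X + deviation Y.
Proof. by rewrite /deviation row_meanD mulmxDr opprD addrACA. Qed.

Lemma deviationZ {r} (a : R) (X : 'M[R]_(n, r)) :
  deviation (a *: X) = a *: deviation X.
Proof. by rewrite /deviation row_meanZ -scalemxAr scalerBr. Qed.

Lemma deviationN {r} (X : 'M[R]_(n, r)) : deviation (- X) = - deviation X.
Proof. by rewrite -scaleN1r deviationZ scaleN1r. Qed.

Lemma mul_ones_row {r} (x : 'rV[R]_r) (i : 'I_n) (j : 'I_r) :
  (ones *m x) i j = x 0 j.
Proof. by rewrite mxE big_ord1 mxE mul1r. Qed.

Lemma row_mean_ones {r} (x : 'rV[R]_r) : row_mean (ones *m x : 'M[R]_(n, r)) = x.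
Proof.
apply/rowP => j; rewrite row_meanE; under eq_bigr do rewrite mul_ones_row.
by rewrite sumr_const card_ord -[X in _ * X]mulr_natl mulKf.
Qed.

Lemma averaging_mul {r} (X : 'M[R]_(n, r)) : avg *m X = ones *m row_mean X.
Proof. by rewrite /averaging_mx -scalemxAl -mulmxA -scalemxAr. Qed.

Lemma tr_averaging : avg^T = avg.
Proof. by rewrite /averaging_mx linearZ/= trmx_mul trmxK. Qed.

Lemma sqr_norm2_ones_mul {r} (x : 'rV[R]_r) :
  norm2 (ones *m x : 'M[R]_(n, r)) ^+ 2 = n%:R * norm2 x ^+ 2.
Proof.
rewrite !sqr_norm2E big_ord1.
rewrite (eq_bigr (fun=> \sum_j x 0 j ^+ 2)) => [|i _]; last first.
  by apply: eq_bigr => j _; rewrite mul_ones_row.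
by rewrite sumr_const card_ord mulr_natl.
Qed.

Lemma mxdot_ones {r} (X : 'M[R]_(n, r)) (x : 'rV[R]_r) :
  mxdot X (ones *m x) = n%:R * mxdot (row_mean X) x.
Proof.
rewrite [RHS]mulr_sumr big_ord1 mulr_sumr /mxdot exchange_big/=.
apply: eq_bigr => j _; rewrite row_meanE mulrA mulVKf// mulr_suml.
by apply: eq_bigr => i _; rewrite mul_ones_row.
Qed.

(** Pythagoras: deviations from the mean are orthogonal to the constant
    columns. *)
Lemma sqr_norm2_deviation {r} (X : 'M[R]_(n, r)) :
  norm2 X ^+ 2 = norm2 (deviation X) ^+ 2 + n%:R * norm2 (row_mean X) ^+ 2.
Proof.
rewrite sqr_norm2B mxdot_ones sqr_norm2_ones_mul mxdot_sqr; ring.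
Qed.

Lemma deviation_le {r} (X : 'M[R]_(n, r)) :
  norm2 (deviation X) ^+ 2 <= norm2 X ^+ 2.
Proof. by rewrite (sqr_norm2_deviation X) lerDl mulr_ge0// sqr_ge0. Qed.

Lemma row_mean_le {r} (X : 'M[R]_(n, r)) :
  n%:R * norm2 (row_mean X) ^+ 2 <= norm2 X ^+ 2.
Proof. by rewrite (sqr_norm2_deviation X) lerDr sqr_ge0. Qed.

Section DoublyStochastic.
Context (W : 'M[R]_n).
Hypothesis W_row : forall i, \sum_j W i j = 1.
Hypothesis W_col : forall j, \sum_i W i j = 1.

Lemma row_mean_stochastic {r} (X : 'M[R]_(n, r)) :
  row_mean (W *m X) = row_mean X.
Proof.
rewrite /row_mean mulmxA; congr (_ *: (_ *m _)); apply/rowP => j.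
by rewrite !mxE -[RHS](W_col j); apply: eq_bigr => i _; rewrite !mxE mul1r.
Qed.

Lemma mul_stochastic_ones : W *m ones = ones.
Proof.
apply/colP => i; rewrite !mxE -[RHS](W_row i).
by apply: eq_bigr => j _; rewrite !mxE mulr1.
Qed.

(** The consensus component is fixed by W and killed by W minus the averaging
    matrix, so mixing acts on deviations through the latter matrix, the spectral
    radius of which is the contraction factor of the network. *)
Lemma mixing_deviation {r} (X : 'M[R]_(n, r)) :
  (W - avg) *m deviation X = W *m X - ones *m row_mean X.
Proof.
rewrite mulmxBl averaging_mul /deviation row_meanB row_mean_ones subrr mulmx0.
by rewrite subr0 mulmxBr mulmxA mul_stochastic_ones.
Qed.

Lemma deviation_stochastic {r} (X : 'M[R]_(n, r)) :
  deviation (W *m X) = (W - avg) *m deviation X.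
Proof. by rewrite mixing_deviation /deviation row_mean_stochastic. Qed.

Lemma stochastic_sub {r} (X : 'M[R]_(n, r)) :
  W *m X - X = (W - avg) *m deviation X - deviation X.
Proof. by rewrite mixing_deviation /deviation opprB addrA subrK. Qed.

End DoublyStochastic.

Lemma d_I_sqr : d_I n ^+ 2 = n%:R - 1 :> R.
Proof.
have := sqr_norm2_deviation (1%:M : 'M[R]_n).
have -> : deviation (1%:M : 'M[R]_n) = 1%:M - avg.
  by rewrite /deviation -averaging_mul mulmx1.
rewrite -/(d_I n).
have -> : norm2 (1%:M : 'M[R]_n) ^+ 2 = n%:R.
  rewrite sqr_norm2E -[in RHS](card_ord n) -sumr_const.
  apply: eq_bigr => i _; rewrite (bigD1 i)//= mxE eqxx expr1n big1 ?addr0//.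
  by move=> j /negPf ji; rewrite mxE eq_sym ji expr0n.
have -> : n%:R * norm2 (row_mean (1%:M : 'M[R]_n)) ^+ 2 = 1.
  rewrite sqr_norm2E big_ord1 (eq_bigr (fun=> n%:R^-1 ^+ 2)) => [|j _].
    by rewrite sumr_const card_ord -[X in _ * X]mulr_natl expr2 mulVKf// mulfV.
  rewrite row_meanE (bigD1 j)//= big1 ?addr0; last first.
    by move=> i /negPf ij; rewrite mxE ij.
  by rewrite mxE eqxx mulr1.
by move->; rewrite addrK.
Qed.

Lemma d_I_ge1 : (2 <= n)%N -> 1 <= d_I n :> R.
Proof.
move=> n2; rewrite -(@ler_pXn2r _ 2)// ?nnegrE ?norm2_ge0//.
by rewrite expr1n d_I_sqr lerBrDr -(natrD _ 1 1) ler_nat.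
Qed.

End Averaging.

(** * Gradients of smooth strongly convex functions *)
Section SmoothConvex.
Context {R : realType} {r : nat}.
Implicit Types (f : 'rV[R]_r -> R) (x y v : 'rV[R]_r).

Lemma derive_grad f x v : differentiable f x ->
  'D_v f x = mxdot (grad f x) v.
Proof.
move=> df; rewrite deriveE// {1}[v]row_sum_delta linear_sum/= -dotrvE.
by apply: eq_bigr => j _; rewrite linearZ/= mxE deriveE// mulrC.
Qed.

(** The mean value theorem applied to the restriction of f to a segment. It
    replaces the integral form of the Taylor remainder in all that follows, at
    the price of a factor 2 in the constants, which the stepsize bound leaves
    room for. *)
Lemma MVT_grad f x v : (forall z, differentiable f z) ->
  exists2 t, 0 <= t <= 1 & f (x + v) - f x = mxdot (grad f (x + t *: v)) v.
Proof.
move=> df; pose g (t : R) := x + t *: v.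
(* The difference quotients of f along the segment and of f in direction v are the
   same function. *)
have dfg (t : R) : is_derive t 1 (f \o g) (mxdot (grad f (g t)) v).
  have E : (fun h : R => h^-1 *: (((f \o g) \o shift t) (h *: 1) - (f \o g) t)) =
           (fun h : R => h^-1 *: ((f \o shift (g t)) (h *: v) - f (g t))).
    apply/funext => h /=; congr (_ *: (f _ - _)).
    by rewrite /g [h *: _]mulr1 scalerDl addrCA.
  rewrite -derive_grad//; apply: DeriveDef; last by rewrite /derive E.
  by rewrite /derivable E; exact: diff_derivable.
have cfg : {within `[0, 1], continuous (f \o g)}.
  apply: derivable_within_continuous => t _; exact: (@ex_derive _ _ _ _ _ _ _ (dfg t)).
have [t t01] := @MVT_segment R (f \o g) _ 0 1 ler01 (fun t _ => dfg t) cfg.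
rewrite /g /= scale1r scale0r addr0 subr0 mulr1 => h.
by exists t; rewrite // -in_itv.
Qed.

Section Descent.
Context (mu L : R) (mu_gt0 : 0 < mu) (L_gt0 : 0 < L) (f : 'rV[R]_r -> R).
Hypothesis hf : strongly_convex_smooth mu L f.

Let df x : differentiable f x. Proof. by case: hf. Qed.

Lemma grad_monotone x y :
  mu * norm2 (x - y) ^+ 2 <= mxdot (grad f x - grad f y) (x - y).
Proof. by case: hf => _ + _ => /(_ x y); rewrite dotrvE. Qed.

Lemma grad_lipschitz x y :
  norm2 (grad f x - grad f y) ^+ 2 <= L ^+ 2 * norm2 (x - y) ^+ 2.
Proof.
case: hf => _ _ /(_ x y) h.
by rewrite -exprMn ler_pXn2r ?nnegrE ?mulr_ge0 ?norm2_ge0// ltW.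
Qed.

Lemma above_tangent x y : mxdot (grad f x) (y - x) <= f y - f x.
Proof.
have [t /andP[t0 t1]] := MVT_grad x (y - x) df.
rewrite (addrC x) subrK => ->.
rewrite -subr_ge0 -mxdotBl; have [->|tn0] := eqVneq t 0.
  by rewrite scale0r addr0 subrr mxdot0l.
have tp : 0 < t by rewrite lt0r tn0.
rewrite -(pmulr_rge0 _ tp) -mxdotZr.
have := grad_monotone (x + t *: (y - x)) x.
rewrite [x + _]addrC addrK; apply: le_trans.
by rewrite mulr_ge0 ?sqr_ge0// ltW.
Qed.

(** Descent lemma. The remainder has constant L instead of the optimal L/2
    because the gradient at the intermediate point is compared to the gradient
    at y in the crudest way. *)
Lemma descent y s (t : R) : 0 < t ->
  f (y - t *: s) - f y <= - t * mxdot (grad f y) s + L * t ^+ 2 * norm2 s ^+ 2.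
Proof.
move=> t0; have [u /andP[u0 u1]] := MVT_grad y (- (t *: s)) df.
set g := grad f _ => ->.
have Lt0 : 0 < L * t by rewrite mulr_gt0.
have gy : norm2 (g - grad f y) ^+ 2 <= (L * t) ^+ 2 * norm2 s ^+ 2.
  apply: le_trans (grad_lipschitz _ _) _.
  rewrite [y + _]addrC addrK sqr_norm2Z sqr_norm2N sqr_norm2Z.
  have u2 : u ^+ 2 <= 1 by rewrite expr_le1.
  have -> : L ^+ 2 * (u ^+ 2 * (t ^+ 2 * norm2 s ^+ 2)) =
            u ^+ 2 * ((L * t) ^+ 2 * norm2 s ^+ 2) by ring.
  by apply: ler_piMl => //; rewrite mulr_ge0 ?sqr_ge0.
have := @mxdot_young _ _ _ (L * t)^-1 (L * t) (- (g - grad f y)) s.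
rewrite invr_gt0 Lt0 mulVf ?gt_eqF// => /(_ isT (lexx _)).
rewrite mxdotNl mxdotBl sqr_norm2N mxdotNr mxdotZr => yo.
have {}gy : (L * t)^-1 * norm2 (g - grad f y) ^+ 2 <= L * t * norm2 s ^+ 2.
  by rewrite ler_pdivrMl// mulrA -expr2.
have : t * (- (2 * (mxdot g s - mxdot (grad f y) s))) <=
       t * (2 * (L * t * norm2 s ^+ 2)).
  by rewrite ler_pM2l//; lra.
lra.
Qed.

(** The tilted function z |-> f z - (grad f x, z) is minimal at x, hence its value
    at x is at most its value after one gradient step of length 1/(2L) from y,
    and the descent lemma quantifies the decrease during that step. *)
Lemma bregman_ge x y :
  (4 * L)^-1 * norm2 (grad f y - grad f x) ^+ 2 <=
  f y - f x - mxdot (grad f x) (y - x).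
Proof.
set s := grad f y - grad f x; set t := (2 * L)^-1.
have t0 : 0 < t by rewrite invr_gt0 mulr_gt0.
have h1 := descent y s t0.
have := above_tangent x (y - t *: s).
rewrite [y - _ - x]addrAC [mxdot _ (y - x - _)]mxdotBr mxdotZr => h2.
have e : mxdot (grad f y) s - mxdot (grad f x) s = norm2 s ^+ 2.
  by rewrite -mxdotBl mxdot_sqr.
have -> : (4 * L)^-1 * norm2 s ^+ 2 = t * norm2 s ^+ 2 - L * t ^+ 2 * norm2 s ^+ 2.
  by rewrite /t; field; rewrite gt_eqF.
by rewrite -[X in t * X - _]e; lra.
Qed.

(** Cocoercivity (Baillon-Haddad) up to a factor 2, by adding the two Bregman
    bounds obtained by exchanging x and y. *)
Lemma grad_cocoercive x y :
  norm2 (grad f x - grad f y) ^+ 2 <=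
  2 * L * mxdot (grad f x - grad f y) (x - y).
Proof.
have := bregman_ge y x; have := bregman_ge x y.
move: (f x) (f y) (grad f x) (grad f y) => a b gx gy h1 h2.
have e : norm2 (gy - gx) ^+ 2 = norm2 (gx - gy) ^+ 2.
  by rewrite -(sqr_norm2N (gx - gy)) opprB.
have e' : mxdot gx (y - x) = - mxdot gx (x - y) by rewrite -mxdotNr opprB.
rewrite e e' in h1; rewrite -ler_pdivrMl ?mulr_gt0// mxdotBl.
have -> : (2 * L)^-1 * norm2 (gx - gy) ^+ 2 =
    2 * ((4 * L)^-1 * norm2 (gx - gy) ^+ 2) by field; rewrite gt_eqF.
lra.
Qed.

(** A gradient step from a minimizer cannot decrease f, whereas the descent
    lemma says that it does unless the gradient vanishes. *)
Lemma minimizer_grad0 x : is_minimizer f x -> grad f x = 0.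
Proof.
move=> hx; set s := grad f x; pose t := (2 * L)^-1.
have t0 : 0 < t by rewrite invr_gt0 mulr_gt0.
have := descent x s t0; rewrite mxdot_sqr => h.
have h' : 0 <= f (x - t *: s) - f x by rewrite subr_ge0; exact: hx.
have : 0 <= - ((4 * L)^-1 * norm2 s ^+ 2).
  suff <- : - t * norm2 s ^+ 2 + L * t ^+ 2 * norm2 s ^+ 2 =
     - ((4 * L)^-1 * norm2 s ^+ 2) by apply: le_trans h.
  by rewrite /t; field; rewrite gt_eqF.
rewrite oppr_ge0 pmulr_rle0 ?invr_gt0 ?mulr_gt0// => s0.
apply/rowP => j; rewrite [RHS]mxE; apply/eqP; rewrite -sqrf_eq0.
rewrite eq_le sqr_ge0 andbT; exact: le_trans (sqr_entry_le _ _ _) s0.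
Qed.

(** Cocoercivity absorbs the quadratic term of the step into the linear one, and
    strong monotonicity turns what remains into a contraction. The factor 3/2
    exceeds the contraction 1 - alpha mu of the statement on purpose: the
    surplus pays for the consensus error in the inexact step. *)
Lemma gradient_step_contracts (alpha : R) x y :
  0 < alpha -> 4 * (alpha * L) <= 1 ->
  norm2 (x - y - alpha *: (grad f x - grad f y)) ^+ 2 <=
  (1 - 3 / 2 * (alpha * mu)) * norm2 (x - y) ^+ 2.
Proof.
move=> a0 aL; rewrite [leLHS]sqr_norm2B mxdotZr sqr_norm2Z.
have c := grad_cocoercive x y; have m := grad_monotone x y.
rewrite (mxdotC (x - y)).
set D := mxdot _ _ in c m *; set X := norm2 (x - y) ^+ 2 in m *.
have D0 : 0 <= D by apply: le_trans m; rewrite mulr_ge0 ?sqr_ge0// ltW.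
have h1 : alpha ^+ 2 * norm2 (grad f x - grad f y) ^+ 2 <=
    alpha ^+ 2 * (2 * L * D) by rewrite ler_wpM2l// sqr_ge0.
have h2 : alpha * (1 - 4 * (alpha * L)) * D >= 0.
  by rewrite mulr_ge0// mulr_ge0 ?subr_ge0// ltW.
have h3 : alpha * (mu * X) <= alpha * D by rewrite ler_pM2l.
lra.
Qed.

End Descent.
End SmoothConvex.

Section MeanObjective.
Context {R : realType} {n r : nat} (n_gt0 : (0 < n)%N).
Context (mu L : R) (L_gt0 : 0 < L).
Context (f : 'I_n -> 'rV[R]_r -> R).
Hypothesis hf : forall i, strongly_convex_smooth mu L (f i).

Lemma row_stacked_grad (X : 'M[R]_(n, r)) i :
  row i (stacked_grad f X) = grad (f i) (row i X).
Proof. by apply/rowP => j; rewrite !mxE. Qed.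

Lemma stacked_grad_lipschitz (X Y : 'M[R]_(n, r)) :
  norm2 (stacked_grad f X - stacked_grad f Y) ^+ 2 <= L ^+ 2 * norm2 (X - Y) ^+ 2.
Proof.
rewrite [norm2 (X - Y) ^+ 2]sqr_norm2_row sqr_norm2_row mulr_sumr.
apply: ler_sum => i _; rewrite !linearB/= !row_stacked_grad.
exact: (grad_lipschitz L_gt0 (hf i)).
Qed.

Lemma row_ones_mul (x : 'rV[R]_r) (i : 'I_n) : row i (ones *m x) = x.
Proof. by apply/rowP => j; rewrite mxE mul_ones_row. Qed.

Lemma grad_mean_objective x :
  grad (mean_objective f) x = row_mean (stacked_grad f (ones *m x)).
Proof.
have dfx i : differentiable (f i) x by case: (hf i).
have E : mean_objective f = n%:R^-1 \*: (\sum_i f i).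
  by apply/funext => y; rewrite /mean_objective/= fct_sumE.
apply/rowP => j; rewrite mxE E deriveZ; last first.
  apply: derivable_sum => i; exact: diff_derivable.
rewrite derive_sum => [|i]; last exact: diff_derivable.
rewrite row_meanE; congr (_ * _); apply: eq_bigr => i _.
by rewrite mxE row_ones_mul mxE.
Qed.

Lemma mean_objective_smooth : strongly_convex_smooth mu L (mean_objective f).
Proof.
have n0 : 0 < n%:R :> R by rewrite ltr0n.
have E : mean_objective f = n%:R^-1 \*: (\sum_i f i).
  by apply/funext => y; rewrite /mean_objective/= fct_sumE.
split=> [x|x y|x y].
- rewrite E; apply: differentiableZ; apply: differentiable_sum => i.
  by case: (hf i).
- rewrite dotrvE !grad_mean_objective -row_meanB.
  rewrite -(ler_pM2l n0) -(mxdot_ones n_gt0) mulrCA -sqr_norm2_ones_mul mulmxBr.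
  rewrite sqr_norm2_row mulr_sumr /mxdot ler_sum// => i _.
  rewrite linearB/= !row_ones_mul.
  have := grad_monotone (hf i) x y; rewrite -dotrvE => h.
  apply: le_trans h _; rewrite le_eqVlt; apply/orP; left; apply/eqP.
  apply: eq_bigr => j _.
  by rewrite -mulmxBr mul_ones_row; congr (_ * _); rewrite !mxE !row_ones_mul.
- rewrite -(@ler_pXn2r _ 2) ?nnegrE ?norm2_ge0//; last first.
    by rewrite mulr_ge0 ?norm2_ge0// ltW.
  rewrite !grad_mean_objective -row_meanB exprMn -(ler_pM2l n0).
  apply: le_trans (row_mean_le n_gt0 _) _.
  apply: le_trans (stacked_grad_lipschitz _ _) _.
  by rewrite -mulmxBr sqr_norm2_ones_mul mulrCA.
Qed.

End MeanObjective.

(** * One iteration, along fixed noise realizations *)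
Section OneStep.
Context {R : realType} {n r : nat} (n_ge2 : (2 <= n)%N).
Context (mu L : R) (mu_gt0 : 0 < mu) (L_gt0 : 0 < L).
Context (f : 'I_n -> 'rV[R]_r -> R).
Hypothesis hf : forall i, strongly_convex_smooth mu L (f i).
Context (xstar : 'rV[R]_r) (xstar_min : is_minimizer (mean_objective f) xstar).
Context (W : 'M[R]_n) (hW : coupling_mx W).
Context (alpha : R) (alpha_gt0 : 0 < alpha).
Hypothesis alpha_mu : alpha * mu < 1.
Hypothesis alpha_L : 4 * (alpha * L) <= 1.
Hypothesis gap_gt0 : 0 < 1 - rho_w W ^+ 2.

Notation rw := (rho_w W).
Notation ro := (spectral_radius (off_diag W)).
Notation Wo := (off_diag W).
Notation G := (stacked_grad f).
Notation F := (mean_objective f).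

Let n_gt0 : (0 < n)%N. Proof. exact: leq_trans n_ge2. Qed.

Let nR_gt0 : 0 < n%:R :> R. Proof. by rewrite ltr0n. Qed.

Let W_row i : \sum_j W i j = 1. Proof. by case: hW => _ _ []. Qed.
Let W_col j : \sum_i W i j = 1. Proof. by case: hW => _ _ []. Qed.

Lemma mixing_contracts (X : 'M[R]_(n, r)) :
  norm2 ((W - averaging_mx) *m X) ^+ 2 <= rw ^+ 2 * norm2 X ^+ 2.
Proof.
apply: sqr_norm2_sym_mul => //; rewrite linearB/= tr_averaging.
by case: hW => _ ->.
Qed.

Lemma off_diag_bound (X : 'M[R]_(n, r)) :
  norm2 (Wo *m X) ^+ 2 <= ro ^+ 2 * norm2 X ^+ 2.
Proof.
apply: sqr_norm2_sym_mul => //; apply/matrixP => i j; rewrite !mxE eq_sym.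
by case: hW => _ /matrixP/(_ i j); rewrite mxE => ->.
Qed.

(** The weight c = (1 - q) / (1 + q), where q is the squared contraction factor,
    gives (1 + c) q = 2 q / (1 + q) <= (1 + q) / 2 and makes the other
    coefficient exactly 2 / (1 - q). *)
Lemma mixing_young (X Y : 'M[R]_(n, r)) :
  norm2 ((W - averaging_mx) *m X + Y) ^+ 2 <=
  (1 + rw ^+ 2) / 2 * norm2 X ^+ 2 + 2 / (1 - rw ^+ 2) * norm2 Y ^+ 2.
Proof.
set q := rw ^+ 2; have q0 : 0 <= q by exact: sqr_ge0.
have q1 : 0 < 1 + q by rewrite ltr_pwDl.
pose c := (1 - q) / (1 + q); pose e := (1 + q) / (1 - q).
have c0 : 0 < c by rewrite divr_gt0.
have ce : 1 <= c * e by rewrite /c /e mulrA divfK ?gt_eqF// mulfV ?gt_eqF.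
apply: le_trans (sqr_norm2D_young _ _ c0 ce) _.
have -> : 1 + e = 2 / (1 - q) by rewrite /e; field; rewrite gt_eqF.
rewrite lerD2r; apply: le_trans (ler_wpM2l _ (mixing_contracts X)) _.
  by rewrite addr_ge0// ltW.
rewrite mulrA ler_wpM2r ?sqr_ge0// -/q.
have -> : 1 + c = 2 / (1 + q) by rewrite /c; field; rewrite gt_eqF.
rewrite mulrAC ler_pdivrMr//.
have := sqr_ge0 (1 - q); lra.
Qed.

Lemma avg_grad_error (x : 'M[R]_(n, r)) :
  n%:R * norm2 (row_mean (G x) - grad F (row_mean x)) ^+ 2 <=
  L ^+ 2 * norm2 (deviation x) ^+ 2.
Proof.
rewrite (grad_mean_objective hf) -row_meanB.
apply: le_trans (row_mean_le n_gt0 _) _.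
exact: stacked_grad_lipschitz.
Qed.

Lemma avg_grad_bound (x : 'M[R]_(n, r)) :
  n%:R * norm2 (row_mean (G x)) ^+ 2 <=
  2 * (n%:R * L ^+ 2) * norm2 (row_mean x - xstar) ^+ 2 +
  2 * L ^+ 2 * norm2 (deviation x) ^+ 2.
Proof.
have sF := mean_objective_smooth n_gt0 L_gt0 hf.
have := sqr_norm2D_le (row_mean (G x) - grad F (row_mean x))
                      (grad F (row_mean x)).
rewrite subrK -(ler_pM2l nR_gt0) => /le_trans; apply.
have h1 := avg_grad_error x.
have := grad_lipschitz L_gt0 sF (row_mean x) xstar.
rewrite (minimizer_grad0 L_gt0 sF xstar_min) subr0 => h2.
have {}h2 := ler_wpM2l (ltW nR_gt0) h2.
lra.
Qed.

Variables (s x eta xi : 'M[R]_(n, r)).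

(** The increment s_{k+1} - s_k of the gradient tracker. Its average is the average
    gradient up to noise, and it obeys a mixing recursion of its own
    ([increment_next]), which is why its deviation, and not that of s, is the
    third quantity of the linear system. *)
Definition increment (s x eta : 'M[R]_(n, r)) : 'M[R]_(n, r) :=
  W *m s + Wo *m eta + G x - s.

Definition next_point (s x eta xi : 'M[R]_(n, r)) : 'M[R]_(n, r) :=
  W *m x + Wo *m xi - alpha *: increment s x eta.

Notation y := (increment s x eta).
Notation x' := (next_point s x eta xi).

Lemma row_mean_increment :
  row_mean y = row_mean (Wo *m eta) + row_mean (G x).
Proof.
rewrite /increment row_meanB !row_meanD row_mean_stochastic//.
by rewrite (addrC (row_mean s)) [_ + _ + row_mean (G x)]addrAC addrK.
Qed.

(** The noiseless part of the next averaged error. *)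
Definition descent_target : 'rV[R]_r :=
  row_mean x - alpha *: row_mean (G x) - xstar.

(** An exact gradient step on the mean objective, perturbed by the difference
    between the averaged local gradients and the gradient at the average. The
    Young weight p / (2 (1 - p)), with p = alpha mu, brings the contraction
    1 - 3/2 p down to 1 - p. *)
Lemma descent_target_le :
  norm2 descent_target ^+ 2 <=
  (1 - alpha * mu) * norm2 (row_mean x - xstar) ^+ 2 +
  2 * alpha * L ^+ 2 / (mu * n%:R) * norm2 (deviation x) ^+ 2.
Proof.
have sF := mean_objective_smooth n_gt0 L_gt0 hf.
pose p := alpha * mu; rewrite -/p.
have p0 : 0 < p by rewrite mulr_gt0.
have p1 : 0 < 1 - p by rewrite subr_gt0.
pose g := grad F (row_mean x).
have -> : descent_target =
    (row_mean x - xstar - alpha *: (g - grad F xstar)) +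
    - (alpha *: (row_mean (G x) - g)).
  rewrite /descent_target (minimizer_grad0 L_gt0 sF xstar_min) subr0.
  rewrite scalerBr opprB addrA subrK.
  by rewrite -!addrA; congr (_ + _); rewrite addrC.
pose c := p / (2 * (1 - p)); pose e := 2 * (1 - p) / p.
have c0 : 0 < c by rewrite divr_gt0// mulr_gt0.
have ce : 1 <= c * e.
  by rewrite /c /e mulrA divfK ?mulfV ?gt_eqF// mulr_gt0.
apply: le_trans (sqr_norm2D_young _ _ c0 ce) _; rewrite sqr_norm2N sqr_norm2Z.
apply: lerD.
  have h := gradient_step_contracts mu_gt0 L_gt0 sF (row_mean x) xstar alpha_gt0 alpha_L.
  apply: le_trans (ler_wpM2l _ h) _; first by rewrite addr_ge0// ltW.
  rewrite mulrA ler_wpM2r ?sqr_ge0// -/p.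
  have -> : 1 + c = (2 - p) / (2 * (1 - p)).
    by rewrite /c; field; rewrite gt_eqF.
  rewrite mulrAC ler_pdivrMr ?mulr_gt0//.
  have := sqr_ge0 p; nra.
have h := avg_grad_error x; rewrite -/g in h.
rewrite mulrA -(ler_pM2l nR_gt0) mulrCA.
apply: le_trans (ler_wpM2l _ h) _.
  by rewrite mulr_ge0 ?sqr_ge0// addr_ge0// divr_ge0 ?ltW// mulr_gt0.
have -> : n%:R * (2 * alpha * L ^+ 2 / (mu * n%:R) * norm2 (deviation x) ^+ 2) =
  (2 / p) * alpha ^+ 2 * (L ^+ 2 * norm2 (deviation x) ^+ 2).
  by rewrite /p; field; rewrite !gt_eqF.
apply: ler_wpM2r; first by rewrite mulr_ge0 ?sqr_ge0.
apply: ler_wpM2r; first exact: sqr_ge0.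
have -> : 1 + e = 2 / p - 1 by rewrite /e; field; rewrite gt_eqF.
by rewrite gerBl.
Qed.

(** The squared noise is bounded without cross terms between the two noise
    sources: averaging over n >= 2 agents gains a factor 1/n, which compensates
    the factor 2 in |a + b|^2 <= 2 |a|^2 + 2 |b|^2. The terms linear in the noise
    are kept as inner products, because they vanish in expectation. *)
Lemma optimality_step :
  norm2 (row_mean x' - xstar) ^+ 2 <=
  (1 - alpha * mu) * norm2 (row_mean x - xstar) ^+ 2 +
  2 * alpha * L ^+ 2 / (mu * n%:R) * norm2 (deviation x) ^+ 2 +
  ro ^+ 2 * (norm2 xi ^+ 2 + alpha ^+ 2 * norm2 eta ^+ 2) +
  2 * (mxdot descent_target (row_mean (Wo *m xi)) -
       alpha * mxdot descent_target (row_mean (Wo *m eta))).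
Proof.
set N1 := row_mean (Wo *m xi); set N2 := row_mean (Wo *m eta).
have -> : row_mean x' - xstar = descent_target + (N1 - alpha *: N2).
  rewrite /next_point row_meanB row_meanD row_mean_stochastic// row_meanZ.
  rewrite row_mean_increment scalerDr -/N1 -/N2 /descent_target.
  by rewrite opprD !addrA; apply/rowP => j; rewrite !mxE; ring.
rewrite sqr_norm2D mxdotBr mxdotZr.
have h := descent_target_le.
have N12 := sqr_norm2B_le N1 (alpha *: N2); rewrite sqr_norm2Z in N12.
have half (X : 'M[R]_(n, r)) :
    2 * norm2 (row_mean (Wo *m X)) ^+ 2 <= ro ^+ 2 * norm2 X ^+ 2.
  apply: le_trans (off_diag_bound X).
  apply: le_trans (row_mean_le n_gt0 _).
  by rewrite ler_wpM2r ?sqr_ge0// ler_nat.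
have h1 := half xi; have h2 := ler_wpM2l (sqr_ge0 alpha) (half eta).
rewrite -/N1 in h1; rewrite -/N2 in h2.
lra.
Qed.

Lemma deviation_next_point :
  deviation x' = ((W - averaging_mx) *m deviation x - alpha *: deviation y) +
                 deviation (Wo *m xi).
Proof.
rewrite /next_point (deviationD (W *m x + _)) (deviationD (W *m x)).
rewrite (deviationN (alpha *: _)) deviationZ deviation_stochastic//.
by rewrite addrAC.
Qed.

Lemma consensus_step :
  norm2 (deviation x') ^+ 2 <=
  (1 + rw ^+ 2) / 2 * norm2 (deviation x) ^+ 2 +
  2 * alpha ^+ 2 / (1 - rw ^+ 2) * norm2 (deviation y) ^+ 2 +
  ro ^+ 2 * norm2 xi ^+ 2 +
  2 * mxdot ((W - averaging_mx) *m deviation x - alpha *: deviation y)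
            (deviation (Wo *m xi)).
Proof.
rewrite deviation_next_point sqr_norm2D.
have h1 := mixing_young (deviation x) (- (alpha *: deviation y)).
rewrite sqr_norm2N sqr_norm2Z in h1.
have h2 := le_trans (deviation_le n_gt0 (Wo *m xi)) (off_diag_bound xi).
lra.
Qed.

(** Only the deviation of x moves under mixing, and the increment splits into its
    deviation and its mean; the mean is controlled by the average gradient, which
    vanishes at the optimum. *)
Lemma step_size_bound :
  norm2 (W *m x - x - alpha *: y) ^+ 2 <=
  8 * n%:R * alpha ^+ 2 * L ^+ 2 * norm2 (row_mean x - xstar) ^+ 2 +
  (8 + 8 * alpha ^+ 2 * L ^+ 2) * norm2 (deviation x) ^+ 2 +
  2 * alpha ^+ 2 * norm2 (deviation y) ^+ 2 +
  4 * alpha ^+ 2 * ro ^+ 2 * norm2 eta ^+ 2.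
Proof.
apply: le_trans (sqr_norm2B_le _ _) _; rewrite sqr_norm2Z.
have h1 : norm2 (W *m x - x) ^+ 2 <= 4 * norm2 (deviation x) ^+ 2.
  rewrite stochastic_sub//; apply: le_trans (sqr_norm2B_le _ _) _.
  have := mixing_contracts (deviation x).
  have : rw ^+ 2 * norm2 (deviation x) ^+ 2 <= 1 * norm2 (deviation x) ^+ 2.
    by apply: ler_wpM2r; [exact: sqr_ge0 | rewrite -subr_ge0; exact: ltW].
  lra.
rewrite [norm2 y ^+ 2](sqr_norm2_deviation n_gt0) row_mean_increment.
have h2 : n%:R * norm2 (row_mean (Wo *m eta) + row_mean (G x)) ^+ 2 <=
    2 * (ro ^+ 2 * norm2 eta ^+ 2) +
    2 * (2 * (n%:R * L ^+ 2) * norm2 (row_mean x - xstar) ^+ 2 +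
         2 * L ^+ 2 * norm2 (deviation x) ^+ 2).
  have := sqr_norm2D_le (row_mean (Wo *m eta)) (row_mean (G x)).
  rewrite -(ler_pM2l nR_gt0) => /le_trans; apply.
  have := le_trans (row_mean_le n_gt0 (Wo *m eta)) (off_diag_bound eta).
  have := avg_grad_bound x; lra.
have {}h2 := ler_wpM2l (sqr_ge0 alpha) h2.
lra.
Qed.

Lemma increment_next (eta' : 'M[R]_(n, r)) :
  increment (s + y) x' eta' =
  W *m y + (Wo *m (eta' - eta) + (G x' - G x)).
Proof.
have sy : s + y = W *m s + Wo *m eta + G x by rewrite addrC subrK.
rewrite -[LHS]/(W *m (s + y) + Wo *m eta' + G x' - (s + y)).
rewrite mulmxDr sy (mulmxBr Wo eta').
move: (W *m y) (Wo *m eta') (G x') => a b c.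
move: (W *m s) (Wo *m eta) (G x) => a' b' c'.
by apply/matrixP => i j; rewrite !mxE; ring.
Qed.

(** The tracker is driven by the change of the local gradients, hence by the
    displacement of x. Only the product of the displacement with the fresh noise
    of x is kept exactly; every other noise term is estimated by its square,
    which the constants of the statement accommodate. *)
Lemma tracking_step (eta' : 'M[R]_(n, r)) :
  norm2 (deviation (increment (s + y) x' eta')) ^+ 2 <=
  32 * n%:R * alpha ^+ 2 * L ^+ 4 / (1 - rw ^+ 2) *
    norm2 (row_mean x - xstar) ^+ 2 +
  64 * L ^+ 2 / (1 - rw ^+ 2) * norm2 (deviation x) ^+ 2 +
  ((1 + rw ^+ 2) / 2 + 16 * alpha ^+ 2 * L ^+ 2 / (1 - rw ^+ 2)) *
    norm2 (deviation y) ^+ 2 +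
  ro ^+ 2 / (1 - rw ^+ 2) *
    (8 * norm2 eta' ^+ 2 + 9 * norm2 eta ^+ 2 + 4 * L ^+ 2 * norm2 xi ^+ 2) +
  8 * L ^+ 2 / (1 - rw ^+ 2) * mxdot (W *m x - x - alpha *: y) (Wo *m xi).
Proof.
rewrite increment_next deviationD deviation_stochastic//.
apply: le_trans (mixing_young _ _) _.
set q := W *m x - x - alpha *: y.
have xq : x' - x = q + Wo *m xi.
  rewrite /next_point /q; move: y (W *m x) (Wo *m xi) => a b c.
  by apply/matrixP => i j; rewrite !mxE; ring.
have h1 := deviation_le n_gt0 (Wo *m (eta' - eta) + (G x' - G x)).
have h2 := sqr_norm2D_le (Wo *m (eta' - eta)) (G x' - G x).
have h3 := off_diag_bound (eta' - eta).
have h4 := ler_wpM2l (sqr_ge0 ro) (sqr_norm2B_le eta' eta).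
have h5 := stacked_grad_lipschitz L_gt0 hf x' x.
have h6 : norm2 (x' - x) ^+ 2 <= 
   8 * n%:R * alpha ^+ 2 * L ^+ 2 * norm2 (row_mean x - xstar) ^+ 2 +
   (8 + 8 * alpha ^+ 2 * L ^+ 2) * norm2 (deviation x) ^+ 2 +
   2 * alpha ^+ 2 * norm2 (deviation y) ^+ 2 +
   4 * alpha ^+ 2 * ro ^+ 2 * norm2 eta ^+ 2 +
   2 * mxdot q (Wo *m xi) + ro ^+ 2 * norm2 xi ^+ 2.
  rewrite xq (sqr_norm2D q).
  have := step_size_bound; have := off_diag_bound xi; rewrite -/q; lra.
have {}h6 := ler_wpM2l (sqr_ge0 L) h6.
have aL2 : 16 * (alpha ^+ 2 * L ^+ 2) <= 1.
  have -> : 16 * (alpha ^+ 2 * L ^+ 2) = (4 * (alpha * L)) ^+ 2 by ring.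
  by rewrite expr_le1// mulr_ge0// ltW// mulr_gt0.
have V0 := sqr_ge0 (norm2 (deviation x)).
have N0 : 0 <= ro ^+ 2 * norm2 eta ^+ 2 by rewrite mulr_ge0 ?sqr_ge0.
have V1 := ler_wpM2r (mulr_ge0 (sqr_ge0 L) V0) aL2.
have N1 := ler_wpM2r N0 aL2.
have Z1 : 0 <= alpha ^+ 2 * L ^+ 2 * norm2 (deviation y) ^+ 2.
  by apply: mulr_ge0; [apply: mulr_ge0|]; exact: sqr_ge0.
have gap_ge0 : 0 <= 2 / (1 - rw ^+ 2) by rewrite divr_ge0// ltW.
set g := 1 - rw ^+ 2 in gap_ge0 *.
have key : norm2 (deviation (Wo *m (eta' - eta) + (G x' - G x))) ^+ 2 <=
   16 * n%:R * alpha ^+ 2 * L ^+ 4 * norm2 (row_mean x - xstar) ^+ 2 +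
   32 * L ^+ 2 * norm2 (deviation x) ^+ 2 +
   8 * alpha ^+ 2 * L ^+ 2 * norm2 (deviation y) ^+ 2 +
   ro ^+ 2 * (4 * norm2 eta' ^+ 2 + 9 / 2 * norm2 eta ^+ 2 + 2 * L ^+ 2 * norm2 xi ^+ 2) +
   4 * L ^+ 2 * mxdot q (Wo *m xi).
  have L2V : 0 <= L ^+ 2 * norm2 (deviation x) ^+ 2 by rewrite mulr_ge0 ?sqr_ge0.
  lra.
have {}key := ler_wpM2l gap_ge0 key.
lra.
Qed.

End OneStep.

(** * Linear recursions with a nonnegative matrix *)
Section PositiveRecursion.
Context {R : realType}.
Notation toC := (real_complex R).

Lemma eigenvalue_real_complex {n} (A : 'M[R]_n) (a : R) :
  eigenvalue A a -> eigenvalue (map_mx toC A) (toC a).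
Proof.
move=> /eigenvalueP[u uA u0]; apply/eigenvalueP; exists (map_mx toC u).
  by rewrite -map_mxM uA map_mxZ.
by rewrite map_mx_eq0.
Qed.

Lemma eigenvalue_le_spectral_radius {n} (A : 'M[R]_n) (a : R) :
  eigenvalue A a -> `|a| <= spectral_radius A.
Proof.
move=> /eigenvalue_real_complex/normc_le_spectral_radius; apply: le_trans.
by rewrite /= expr0n/= addr0 sqrtr_sqr.
Qed.

(** Otherwise 1 would be an eigenvalue. *)
Lemma unitmx_sub_spectral {n} (A : 'M[R]_n) :
  spectral_radius A < 1 -> 1%:M - A \in unitmx.
Proof.
move=> A1; rewrite -row_free_unit -opprB /row_free mxrank_opp -/(row_free _).
rewrite -kermx_eq0; apply: contraTT A1 => k0; rewrite -leNgt.
rewrite -[leLHS]normr1; exact: eigenvalue_le_spectral_radius.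
Qed.

(** The distance to the fixed point th is dominated by a multiple of the positive
    eigenvector v at time 0, and this domination propagates because A is
    nonnegative and scales v by l. Using a positive eigenvector, rather than
    matrix norms, gives the rate l^k without polynomial factors. *)
Lemma positive_recursion {n} (A : 'M[R]_n) (B th v : 'cV[R]_n) (l : R)
    (U : nat -> 'cV[R]_n) :
  (forall i j, 0 <= A i j) -> (forall i, 0 < v i 0) -> A *m v = l *: v ->
  A *m th + B = th ->
  (forall k i, U k.+1 i 0 <= (A *m U k + B) i 0) ->
  exists c, forall k i, U k i 0 <= th i 0 + c * l ^+ k * v i 0.
Proof.
move=> A0 v0 Av thE UA.
(* Any constant with U 0 - th <= c v entrywise will do. *)
pose c := \sum_i `|U 0%N i 0 - th i 0| / v i 0.
exists c => k; elim: k => [|k IH] i.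
  rewrite expr0 mulr1 -lerBlDl -ler_pdivrMr//.
  apply: (@le_trans _ _ (`|U 0%N i 0 - th i 0| / v i 0)).
    by rewrite ler_wpM2r ?ler_norm// invr_ge0 ltW.
  rewrite /c (bigD1 i)//= lerDl sumr_ge0// => j _.
  by rewrite divr_ge0// ltW.
apply: le_trans (UA k i) _; rewrite -{1}thE !mxE addrAC lerD2r.
apply: (@le_trans _ _ (\sum_j A i j * (th j 0 + c * l ^+ k * v j 0))).
  by apply: ler_sum => j _; rewrite ler_wpM2l.
under eq_bigr do rewrite mulrDr; rewrite big_split/= lerD2l.
under eq_bigr do rewrite mulrCA; rewrite -mulr_sumr exprSr.
have /colP/(_ i) := Av; rewrite !mxE => ->.
by rewrite !mulrA.
Qed.

(** The Perron root of this matrix is found by hand. Its characteristic polynomial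
    is negative at the largest diagonal entry and positive at 1, the latter being
    the last hypothesis, so it has a root l in between. Being larger than all the
    diagonal entries, l has an explicit positive right eigenvector, so that it
    dominates the modulus of every eigenvalue; an explicit left eigenvector shows
    that it is an eigenvalue. *)
Lemma cyclic_perron (a b c e f g h : R) :
  0 <= a < 1 -> 0 <= c < 1 -> 0 <= h < 1 ->
  0 < b -> 0 < e -> 0 < f -> 0 <= g ->
  0 < (1 - a) * (1 - c) * (1 - h) - g * e * (1 - a) - f * b * e ->
  let A : 'M[R]_3 := mx_of_rows
    [:: [:: a; b; 0]; [:: 0; c; e]; [:: f; g; h]] in
  exists v : 'cV[R]_3, [/\ forall i, 0 < v i 0,
    A *m v = spectral_radius A *: v, 0 <= spectral_radius A &
    spectral_radius A < 1].
Proof.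
move=> /andP[a0 a1] /andP[c0 c1] /andP[h0 h1] b0 e0 f0 g0 p1 A.
pose P : {poly R} := ('X - a%:P) * ('X - c%:P) * ('X - h%:P)
  - (g * e)%:P * ('X - a%:P) - (f * b * e)%:P.
have PE x : P.[x] = (x - a) * (x - c) * (x - h) - g * e * (x - a) - f * b * e.
  by rewrite /P !hornerE.
have fbe : 0 < f * b * e by rewrite !mulr_gt0.
pose m := Num.max a (Num.max c h).
have am : a <= m by rewrite le_max lexx.
have cm : c <= m by rewrite !le_max lexx orbT.
have hm : h <= m by rewrite !le_max lexx !orbT.
have m1 : m < 1 by rewrite !gt_max a1 c1 h1.
have Pm : P.[m] < 0.
  have m3 : (m - a) * (m - c) * (m - h) = 0.
    rewrite /m; case: (leP c h) => _; case: leP => _; rewrite subrr; ring.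
  rewrite PE m3 sub0r -opprD oppr_lt0 ltr_wpDl// mulr_ge0 ?subr_ge0//.
  by rewrite mulr_ge0// ltW.
have [l /andP[ml l1] /rootP Pl] : exists2 l, m <= l <= 1 & root P l.
  by apply: poly_ivt; rewrite ?ltW// PE.
have {}ml : m < l.
  by rewrite lt_neqAle ml andbT; apply: contraTneq Pm => ->; rewrite Pl ltxx.
have {}l1 : l < 1.
  rewrite lt_neqAle l1 andbT; apply: contraTneq p1 => <-.
  by rewrite -PE Pl ltxx.
have la : 0 < l - a by rewrite subr_gt0; exact: le_lt_trans ml.
have lc : 0 < l - c by rewrite subr_gt0; exact: le_lt_trans ml.
have lh : 0 < l - h by rewrite subr_gt0; exact: le_lt_trans ml.
have l0 : 0 < l by apply: le_lt_trans ml; exact: le_trans am.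
have {Pl PE}Pl : (l - a) * (l - c) * (l - h) = g * e * (l - a) + f * b * e.
  by move: Pl; rewrite PE; lra.
(* Solve the first two rows of A v = l v upwards from the last entry and clear the
   denominators l - a and l - c; the third row is the characteristic equation. *)
pose v : 'cV[R]_3 := mx_of_rows
  [:: [:: b * e]; [:: e * (l - a)]; [:: (l - a) * (l - c)]].
have v0 i : 0 < v i 0.
  rewrite mxE; case: i => -[|[|[|//]]] ? /=; exact: mulr_gt0.
have Av : A *m v = l *: v.
  apply/colP => i; rewrite !mxE !big_ord_recl big_ord0 !mxE /=.
  by case: i => -[|[|[|//]]] ? /=; lra.
have A0 i j : 0 <= A i j.
  by rewrite mxE; case: i => -[|[|[|//]]] ?; case: j => -[|[|[|//]]] ? /=;
    rewrite // ltW.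
have ev : eigenvalue A l.
  apply/eigenvalueP; exists (mx_of_rows
    [:: [:: f * e; (l - a) * (l - h); e * (l - a)]]).
    apply/rowP => i; rewrite !mxE !big_ord_recl big_ord0 !mxE /=.
    by case: i => -[|[|[|//]]] ? /=; lra.
  apply/eqP => /rowP/(_ 0); rewrite !mxE /= => /eqP.
  by rewrite gt_eqF// mulr_gt0.
suff -> : spectral_radius A = l by exists v; split => //; exact: ltW.
apply/eqP; rewrite eq_le; apply/andP; split; last first.
  by have := eigenvalue_le_spectral_radius ev; rewrite gtr0_norm.
apply: spectral_radius_le => // z.
apply: (@eigenvalue_le_weighted _ _ _ (v ^~ 0)) => // i.
have /colP/(_ i) := Av; rewrite !mxE => <-.
by apply: ler_sum => j _; rewrite ger0_norm.
Qed.

End PositiveRecursion.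

(** * Measurability of Lipschitz functions of random vectors *)
Section LipschitzMeasurable.
Context {R : realType} {r : nat}.

Lemma rat_row_dense (x : 'rV[R]_r) (e : R) : 0 < e ->
  exists q : 'rV[rat]_r, norm2 (x - map_mx ratr q) <= e.
Proof.
move=> e0; pose d := e / r.+1%:R.
have d0 : 0 < d by rewrite divr_gt0.
have approx j : exists q : rat, `|x 0 j - ratr q| < d.
  have /rat_in_itvoo[q] : x 0 j - d < x 0 j + d by rewrite ltrBlDr -addrA ltrDl addr_gt0.
  rewrite in_itv/= => /andP[q1 q2]; exists q.
  rewrite ltr_norml; move: (ratr q) q1 q2 => q' q1 q2.
  by apply/andP; split; lra.
have [q Hq] := choice approx.
exists (\row_j q j).
rewrite -(@ler_pXn2r _ 2) ?nnegrE ?norm2_ge0// ?(ltW e0)//.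
rewrite sqr_norm2E big_ord1.
apply: (@le_trans _ _ (\sum_(j < r) d ^+ 2)).
  apply: ler_sum => j _; rewrite !mxE -real_normK ?num_real//.
  by rewrite ler_pXn2r ?nnegrE// ltW.
rewrite sumr_const card_ord -[leLHS]mulr_natl /d expr_div_n mulrA.
rewrite ler_pdivrMr ?exprn_gt0// mulrC ler_wpM2l ?sqr_ge0//.
rewrite -natrX ler_nat expnS expn1.
by rewrite (leq_trans (leqnSn r))// leq_pmulr.
Qed.

Lemma measurable_fun_norm2 d (T : measurableType d) m n (X : T -> 'M[R]_(m, n)) :
  (forall i j, measurable_fun setT (fun w => X w i j)) ->
  measurable_fun setT (fun w => norm2 (X w)).
Proof.
move=> mX; have msqrt : measurable_fun setT (Num.sqrt : R -> R).
  by apply: continuous_measurable_fun; exact: sqrt_continuous.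
apply: (measurableT_comp msqrt).
apply: measurable_sum => i; apply: measurable_sum => j.
exact: measurable_funX.
Qed.

(** McShane's formula: a Lipschitz function is the supremum, over the countably
    many rational points q, of the functions g q - C |x - q|. Hence its strict
    superlevel sets are countable unions of measurable sets. *)
Lemma measurable_fun_lipschitz d (T : measurableType d) (g : 'rV[R]_r -> R)
    (C : R) (X : T -> 'rV[R]_r) :
  0 < C -> (forall x y, `|g x - g y| <= C * norm2 (x - y)) ->
  (forall j, measurable_fun setT (fun w => X w 0 j)) ->
  measurable_fun setT (fun w => g (X w)).
Proof.
move=> C0 gC mX.
apply: (measurability _ (RGenOInfty.measurableE R)) => //.
move=> _ [_ [a ->] <-]; rewrite setTI.
pose Q (q : 'rV[rat]_r) : 'rV[R]_r := map_mx ratr q.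
(* The rational point has to be within a third of the available gap, divided by C:
   the Lipschitz error is then paid twice. *)
rewrite [X in measurable X](_ : _ = \bigcup_(q : 'rV[rat]_r)
    [set w | a < g (Q q) - C * norm2 (X w - Q q)]).
  apply: countable_bigcupT_measurable => [|q]; first exact: countableP.
  rewrite -preimage_itvoy -[X in measurable X]setTI.
  suff mF : measurable_fun setT (fun w => g (Q q) - C * norm2 (X w - Q q)).
    by apply: mF.
  apply: measurable_funB => //; apply: measurable_funM => //.
  apply: measurable_fun_norm2 => i j; rewrite ord1.
  under eq_fun do rewrite !mxE.
  exact: measurable_funB.
apply/seteqP; split => w /=.
  rewrite in_itv/= andbT => aw.
  have [|q Hq] := @rat_row_dense (X w) ((g (X w) - a) / (C * 3)).
    by rewrite divr_gt0 ?subr_gt0// mulr_gt0.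
  exists q => //=.
  have := gC (X w) (Q q); rewrite ler_norml => /andP[_ h].
  have {Hq} : C * norm2 (X w - Q q) <= (g (X w) - a) / 3.
    rewrite -ler_pdivlMl//; apply: le_trans Hq _.
    by rewrite le_eqVlt; apply/orP; left; apply/eqP; field; rewrite gt_eqF.
  lra.
move=> [q _ /= aq]; rewrite in_itv/= andbT.
have := gC (X w) (Q q); rewrite ler_norml => /andP[h _].
lra.
Qed.

End LipschitzMeasurable.

(** * Square-integrable random variables *)
Section SquareIntegrable.
Context {d : measure_display} {T : measurableType d} {R : realType}.
Variable P : probability T R.
Implicit Types f g : T -> R.

Definition integrableR f := P.-integrable setT (EFin \o f).

Definition square_integrable f :=
  measurable_fun setT f /\ integrableR (fun w => f w ^+ 2).

Lemma integrableR_le f g : measurable_fun setT f ->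
  (forall w, `|f w| <= g w) -> integrableR g -> integrableR f.
Proof.
move=> mf fg; apply: le_integrable => //; first exact/measurable_EFinP.
by move=> w _; rewrite /= lee_fin (le_trans (fg w))// ler_norm.
Qed.

Lemma integrableR_cst c : integrableR (fun=> c).
Proof. exact: finite_measure_integrable_cst. Qed.

Lemma integrableRD f g : integrableR f -> integrableR g ->
  integrableR (fun w => f w + g w).
Proof. exact: integrableD. Qed.

Lemma integrableRZ c f : integrableR f -> integrableR (fun w => c * f w).
Proof. exact: integrableZl. Qed.

Lemma integrableR_sum (I : Type) (s : seq I) (f : I -> T -> R) :
  (forall i, integrableR (f i)) -> integrableR (fun w => \sum_(i <- s) f i w).
Proof.
move=> hf; elim: s => [|i s IH].
  by under eq_fun do rewrite big_nil; exact: integrableR_cst.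
by under eq_fun do rewrite big_cons; exact: integrableRD.
Qed.

Lemma square_integrable_cst c : square_integrable (fun=> c).
Proof. by split => //; exact: integrableR_cst. Qed.

Lemma square_integrable_le f g : measurable_fun setT f ->
  (forall w, f w ^+ 2 <= g w) -> integrableR g -> square_integrable f.
Proof.
move=> mf fg ig; split => //; apply: integrableR_le ig.
  exact: measurable_funX.
by move=> w; rewrite ger0_norm ?sqr_ge0.
Qed.

Lemma square_integrableD f g : square_integrable f -> square_integrable g ->
  square_integrable (fun w => f w + g w).
Proof.
move=> [mf f2] [mg g2].
apply: (@square_integrable_le _ (fun w => 2 * f w ^+ 2 + 2 * g w ^+ 2)).
- exact: measurable_funD.
- by move=> w; have := sqr_ge0 (f w - g w); lra.
- by apply: integrableRD; exact: integrableRZ.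
Qed.

Lemma square_integrableZ c f : square_integrable f ->
  square_integrable (fun w => c * f w).
Proof.
move=> [mf f2].
apply: (@square_integrable_le _ (fun w => c ^+ 2 * f w ^+ 2)).
- exact: measurable_funM.
- by move=> w; rewrite exprMn.
- exact: integrableRZ.
Qed.

Lemma square_integrableM f g : square_integrable f -> square_integrable g ->
  integrableR (fun w => f w * g w).
Proof.
move=> [mf f2] [mg g2].
apply: (@integrableR_le _ (fun w => f w ^+ 2 + g w ^+ 2)).
- exact: measurable_funM.
- move=> w; rewrite ler_norml; apply/andP; split.
    by have := sqr_ge0 (f w + g w); have := sqr_ge0 (f w); have := sqr_ge0 (g w); lra.
  by have := sqr_ge0 (f w - g w); have := sqr_ge0 (f w); have := sqr_ge0 (g w); lra.
- exact: integrableRD.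
Qed.

Lemma square_integrableW f : square_integrable f -> integrableR f.
Proof.
move=> f2; have := square_integrableM (square_integrable_cst 1) f2.
by under eq_fun do rewrite mul1r.
Qed.

Lemma integrableR_ge0 f c : measurable_fun setT f -> (forall w, 0 <= f w) ->
  ('E_P[f] <= c%:E)%E -> integrableR f.
Proof.
move=> mf f0 fc; apply/integrableP; split; first exact/measurable_EFinP.
apply: le_lt_trans (ltry c); apply: le_trans fc; rewrite unlock.
rewrite le_eqVlt; apply/orP; left; apply/eqP; apply: eq_integral => w _.
by rewrite /= ger0_norm.
Qed.

Lemma expectation_Rintegral f : integrableR f ->
  'E_P[f]%E = (\int[P]_w f w)%:E.
Proof.
by move=> hf; rewrite unlock /Rintegral fineK// integrable_fin_num.
Qed.

End SquareIntegrable.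

(** * Independence of one noise entry from all the others *)
Section Independence.
Context {d : measure_display} {T : measurableType d} {R : realType}.
Variable P : probability T R.
Context {I : eqType} (X : I -> {RV P >-> R}).
Hypothesis X_indep : mutually_independent X.

(** The finite-dimensional cylinder sets that do not involve the q-th variable.
    They form a pi-system generating the sigma-algebra of all the other
    variables. *)
Definition cylinders_without (q : I) : set (set T) :=
  [set S | exists J B, [/\ uniq J, q \notin J,
     forall i, measurable (B i : set R) &
     S = \bigcap_(i in [set` J]) (X i @^-1` B i)]].

Definition measurable_without (q : I) (Y : T -> R) : Prop :=
  measurable_fun setT (Y : g_sigma_algebraType (cylinders_without q) -> R).

Lemma cylinders_without_preimage q i (B : set R) : i != q -> measurable B ->
  cylinders_without q (X i @^-1` B).
Proof.
move=> iq mB; exists [:: i], (fun=> B); split => //.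
  by rewrite mem_seq1 eq_sym.
by apply/seteqP; split => w /=; [move=> ? j /=; rewrite mem_seq1 => /eqP -> |
  move=> /(_ i) /=; apply; rewrite mem_seq1].
Qed.

Lemma cylinders_without_setI q : setI_closed (cylinders_without q).
Proof.
move=> _ _ [J1 [B1 [u1 q1 m1 ->]]] [J2 [B2 [u2 q2 m2 ->]]].
exists (undup (J1 ++ J2)), (fun i =>
  (if i \in J1 then B1 i else setT) `&` (if i \in J2 then B2 i else setT)).
split.
- exact: undup_uniq.
- by rewrite mem_undup mem_cat negb_or q1.
- by move=> i; apply: measurableI; case: ifP.
- apply/seteqP; split => w /=.
    by move=> [h1 h2] i /= _; split; case: ifP => //= ij; [exact: h1|exact: h2].
  move=> h; split => i /= ij; have /= := h i.
    by rewrite mem_undup mem_cat ij => /(_ isT)[].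
  by rewrite mem_undup mem_cat ij orbT => /(_ isT)[].
Qed.

Lemma measurable_rv_preimage i (B : set R) :
  measurable B -> measurable (X i @^-1` B).
Proof. by move=> mB; rewrite -[Y in measurable Y]setTI; exact: measurable_funP. Qed.

Lemma measurable_cylinders_without q S :
  <<s cylinders_without q >> S -> measurable S.
Proof.
apply: smallest_sub; first exact: sigma_algebra_measurable.
move=> _ [J [B [_ _ mB ->]]].
apply: fin_bigcap_measurable; first exact: finite_seq.
by move=> i _; exact: measurable_rv_preimage.
Qed.

Local Open Scope ereal_scope.

Lemma independent_cylinder q (A : set R) S : measurable A ->
  cylinders_without q S ->
  P (X q @^-1` A `&` S) = P (X q @^-1` A) * P S.
Proof.
move=> mA [J [B [uJ qJ mB ->]]].
pose B' i := if i == q then A else B i.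
have h1 := @X_indep (q :: J) B'.
have h2 := X_indep uJ mB.
rewrite h2 -[X in X * _]fineK; last first.
  exact/fin_num_measure/measurable_rv_preimage.
rewrite -EFinM.
have <- : (\prod_(i <- q :: J) fine (P (X i @^-1` B' i)) =
  fine (P (X q @^-1` A)) * \prod_(i <- J) fine (P (X i @^-1` B i)))%R.
  rewrite big_cons /B' eqxx; congr (_ * _)%R.
  rewrite big_seq [RHS]big_seq; apply: eq_bigr => i iJ.
  by case: eqP => // iq; move: qJ; rewrite -iq iJ.
rewrite -h1 /=; last 2 first.
- by rewrite qJ.
- by move=> i; rewrite /B'; case: ifP.
congr (P _); apply/seteqP; split => w /=.
  move=> [wA wB] i /=; rewrite inE /B'; case: eqP => [->//|_ /= iJ].
  exact: wB.
move=> h; split.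
  by have /= := h q; rewrite inE eqxx /B' eqxx; exact.
move=> i /= iJ; have /= := h i; rewrite inE iJ orbT /B'.
by case: eqP => [iq|_]; [move: qJ; rewrite -iq iJ|exact].
Qed.

(** Dynkin's theorem: the events independent of a given one form a lambda-system,
    which contains the cylinders. *)
Lemma independent_sigma_algebra q (A : set R) S : measurable A ->
  <<s cylinders_without q >> S ->
  P (X q @^-1` A `&` S) = P (X q @^-1` A) * P S.
Proof.
move=> mA.
have mE : measurable (X q @^-1` A) by exact: measurable_rv_preimage.
set E := X q @^-1` A in mE *.
pose D := [set S | measurable S /\ P (E `&` S) = P E * P S].
have Efin : P E \is a fin_num by exact: fin_num_measure.
suff sub : <<s cylinders_without q >> `<=` D by move=> /sub[].
apply: lambda_system_subset => //.
- exact: cylinders_without_setI.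
- apply/dynkin_lambda_system; split.
  + by split => //; rewrite setIT probability_setT mule1.
  + move=> B [mB EB]; split; first exact: measurableC.
    rewrite -setDE measureD//; last by rewrite -ge0_fin_numE// fin_num_measure.
    rewrite [X in _ - X]EB probability_setC// muleBr ?mule1//.

  + move=> F tF DF; split; first by apply: bigcup_measurable => k _; case: (DF k).
    rewrite setI_bigcupr !measure_bigcup//=.
    * rewrite -(fineK Efin) -nneseriesZl//; apply: eq_eseriesr => k _.
      by rewrite fineK//; case: (DF k).
    * by move=> k _; case: (DF k).
    * by move=> k _; apply: measurableI => //; case: (DF k).
    * exact: trivIset_setIl.
- move=> B cB; split; last exact: independent_cylinder.
  by apply: (@measurable_cylinders_without q); exact: sub_sigma_algebra.
Qed.

(** The joint law of X q and Y is the product of their laws, since both agree on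
    rectangles; Fubini then factors the expectation of the product. *)
Lemma expectation_mul_independent q (Y : T -> R) :
  measurable_without q Y -> square_integrable P (X q) -> square_integrable P Y ->
  'E_P[X q] = 0 -> (\int[P]_w (X q w * Y w) = 0)%R.
Proof.
move=> GY X2 Y2 EX; have [mY _] := Y2.
pose Ym : {mfun T >-> R} := HB.pack Y (isMeasurableFun.Build _ _ _ _ Y mY).
have mXY : measurable_fun setT (fun w => (X q w, Y w)).
  by apply: measurable_fun_pair => //; exact: measurable_funP.
pose XY : {mfun T >-> (R * R)%type} :=
  HB.pack (fun w => (X q w, Y w)) (isMeasurableFun.Build _ _ _ _ _ mXY).
pose m1 := distribution P (X q).
pose m2 := distribution P Ym.
pose m := distribution P XY.
have mE S : measurable S -> (m1 \x m2) S = m S.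
  move=> mS; apply: product_measure_unique => // A B mA mB.
  rewrite /m /m1 /m2 /distribution /pushforward.
  rewrite -independent_sigma_algebra//.
  by rewrite -[X in <<s _ >> X]setTI; exact: GY.
pose h (z : R * R) := (z.1 * z.2)%:E.
have mh : measurable_fun setT h.
  apply/measurable_EFinP; apply: measurable_funM.
    exact: measurable_fst.
  exact: measurable_snd.
have iXY : P.-integrable setT (h \o XY) by exact: square_integrableM X2 Y2.
have im : m.-integrable setT h by exact: integrable_pushforward.
have imm : (m1 \x m2).-integrable setT h.
  apply/integrableP; split => //.
  have /integrableP[_] := im; congr (_ < _).
  by apply: eq_measure_integral => S mS _; first [exact: mE | exact: esym (mE _ mS)].
rewrite /Rintegral.
have -> : \int[P]_w (X q w * Y w)%:E = \int[m]_z h z.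
  by rewrite integral_distribution.
have -> : \int[m]_z h z = \int[m1 \x m2]_z h z.
  by apply: eq_measure_integral => S mS _; first [exact: mE | exact: esym (mE _ mS)].
rewrite -integral12_prod_meas1//.
have im2 : m2.-integrable setT EFin.
  by apply: integrable_pushforward => //; exact: square_integrableW Y2.
have im1 : m1.-integrable setT EFin.
  by apply: integrable_pushforward => //; exact: square_integrableW X2.
rewrite (eq_integral (fun x => (fine (\int[m2]_y y%:E))%:E * x%:E)); last first.
  move=> x _; rewrite /h /= muleC fineK; last exact: integrable_fin_num.
  by rewrite -integralZl//; apply: eq_integral => y _; rewrite EFinM.
have m10 : \int[m1]_x x%:E = 0.
  rewrite -EX unlock integral_distribution//; exact: square_integrableW X2.
by rewrite integralZl// m10 mule0.
Qed.

End Independence.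

(** * Regularity of the iterates *)
Section LipschitzClosed.
Context {R : realType} {T : Type} (Q : (T -> R) -> Prop).

(** The closure properties needed to follow the iterates. They are shared by the
    functions measurable for a given sigma-algebra and by the square-integrable
    ones, so that the induction along the algorithm is done once. The gradients
    enter through the last property alone. *)
Definition lipschitz_closed : Prop :=
  [/\ forall c, Q (fun=> c),
      forall f g, Q f -> Q g -> Q (fun w => f w + g w),
      forall c f, Q f -> Q (fun w => c * f w)
    & forall r (g : 'rV[R]_r -> R) C (X : T -> 'rV[R]_r), 0 < C ->
        (forall x y, `|g x - g y| <= C * norm2 (x - y)) ->
        (forall j, Q (fun w => X w 0 j)) -> Q (fun w => g (X w))].

Definition entries {m p} (M : T -> 'M[R]_(m, p)) : Prop :=
  forall i j, Q (fun w => M w i j).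

Hypothesis Qcl : lipschitz_closed.

Lemma closed_sum (I : Type) (s : seq I) (f : I -> T -> R) :
  (forall i, Q (f i)) -> Q (fun w => \sum_(i <- s) f i w).
Proof.
case: Qcl => Qc QD _ _ hf; elim: s => [|i s IH].
  by under eq_fun do rewrite big_nil; exact: Qc.
by under eq_fun do rewrite big_cons; exact: QD.
Qed.

Lemma entries_cst {m p} (M : 'M[R]_(m, p)) : entries (fun=> M).
Proof. by case: Qcl => Qc _ _ _ i j; exact: Qc. Qed.

Lemma entriesD {m p} (M N : T -> 'M[R]_(m, p)) :
  entries M -> entries N -> entries (fun w => M w + N w).
Proof.
case: Qcl => _ QD _ _ hM hN i j; under eq_fun do rewrite mxE; exact: QD.
Qed.

Lemma entriesZ {m p} (c : R) (M : T -> 'M[R]_(m, p)) :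
  entries M -> entries (fun w => c *: M w).
Proof.
case: Qcl => _ _ QZ _ hM i j; under eq_fun do rewrite mxE; exact: QZ.
Qed.

Lemma entriesB {m p} (M N : T -> 'M[R]_(m, p)) :
  entries M -> entries N -> entries (fun w => M w - N w).
Proof.
move=> hM hN; apply: entriesD => //.
by under eq_fun do rewrite -scaleN1r; exact: entriesZ.
Qed.

Lemma entries_mul {l m p} (A : 'M[R]_(l, m)) (M : T -> 'M[R]_(m, p)) :
  entries M -> entries (fun w => A *m M w).
Proof.
case: Qcl => _ _ QZ _ hM i j; under eq_fun do rewrite mxE.
by apply: closed_sum => k; exact: QZ.
Qed.

Lemma entries_row_mean {n r} (M : T -> 'M[R]_(n, r)) :
  entries M -> entries (fun w => row_mean (M w)).
Proof. by move=> hM; apply: entriesZ; exact: entries_mul. Qed.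

Lemma entries_deviation {n r} (M : T -> 'M[R]_(n, r)) :
  entries M -> entries (fun w => deviation (M w)).
Proof.
by move=> hM; apply: entriesB => //; apply: entries_mul; exact: entries_row_mean.
Qed.

Section Iterates.
Context {n r : nat} (mu L : R) (L_gt0 : 0 < L) (f : 'I_n -> 'rV[R]_r -> R).
Hypothesis hf : forall i, strongly_convex_smooth mu L (f i).
Context (W : 'M[R]_n) (alpha : R) (s0 x0 : 'M[R]_(n, r)).

Lemma entries_stacked_grad (M : T -> 'M[R]_(n, r)) :
  entries M -> entries (fun w => stacked_grad f (M w)).
Proof.
case: Qcl => _ _ _ Qg hM i j; under eq_fun do rewrite mxE.
apply: (Qg r (fun x => grad (f i) x 0 j) L (fun w => row i (M w))) => //.
  move=> x y; case: (hf i) => _ _ /(_ x y); apply: le_trans.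
  rewrite -(@ler_pXn2r _ 2) ?nnegrE ?norm2_ge0// real_normK ?num_real//.
  by have := sqr_entry_le (grad (f i) x - grad (f i) y) 0 j; rewrite !mxE.
by move=> j'; under eq_fun do rewrite mxE; exact: hM.
Qed.

Lemma entries_increment (s x e : T -> 'M[R]_(n, r)) :
  entries s -> entries x -> entries e ->
  entries (fun w => increment f W (s w) (x w) (e w)).
Proof.
move=> hs hx he; apply: entriesB => //; apply: entriesD.
  by apply: entriesD; exact: entries_mul.
exact: entries_stacked_grad.
Qed.

Notation it eta xi k w := (iterates f W alpha s0 x0 (eta ^~ w) (xi ^~ w) k).

Lemma iteratesS (eta xi : nat -> T -> 'M[R]_(n, r)) k w :
  it eta xi k.+1 w =
  let y := increment f W (it eta xi k w).1 (it eta xi k w).2 (eta k w) in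
  ((it eta xi k w).1 + y,
   next_point f W alpha (it eta xi k w).1 (it eta xi k w).2 (eta k w) (xi k w)).
Proof.
rewrite [LHS]/=; case: (it eta xi k w) => s x /=.
by rewrite /next_point /increment [s + _]addrC subrK.
Qed.

Lemma entries_iterates (eta xi : nat -> T -> 'M[R]_(n, r)) k :
  (forall l, (l < k)%N -> entries (eta l) /\ entries (xi l)) ->
  entries (fun w => (it eta xi k w).1) /\ entries (fun w => (it eta xi k w).2).
Proof.
elim: k => [|k IH] hnoise; first by split; exact: entries_cst.
have [|hs hx] := IH; first by move=> l lk; apply: hnoise; exact: ltnW.
have [he hx'] := hnoise k (ltnSn k).
have hy := entries_increment hs hx he.
split; under eq_fun do rewrite iteratesS /=; first exact: entriesD.
apply: entriesB; first by apply: entriesD; exact: entries_mul.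
exact: entriesZ.
Qed.

End Iterates.
End LipschitzClosed.

Lemma measurable_lipschitz_closed {R : realType} d (T : measurableType d) :
  lipschitz_closed (fun f : T -> R => measurable_fun setT f).
Proof.
split => [c|f g mf mg|c f mf|r g C X C0 gC mX].
- exact: measurable_cst.
- exact: measurable_funD.
- exact: measurable_funM.
- exact: measurable_fun_lipschitz gC mX.
Qed.

Section SquareIntegrableEntries.
Context {d : measure_display} {T : measurableType d} {R : realType}.
Variable P : probability T R.

Lemma integrable_sqr_norm2 {m p} (M : T -> 'M[R]_(m, p)) :
  entries (square_integrable P) M -> integrableR P (fun w => norm2 (M w) ^+ 2).
Proof.
move=> hM; under eq_fun do rewrite sqr_norm2E.
apply: integrableR_sum => i; apply: integrableR_sum => j.
by case: (hM i j).
Qed.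

Lemma square_integrable_lipschitz_closed :
  lipschitz_closed (square_integrable P).
Proof.
split => [c|f g|c f|r g C X C0 gC X2].
- exact: square_integrable_cst.
- exact: square_integrableD.
- exact: square_integrableZ.
apply: (@square_integrable_le _ _ _ _ _
    (fun w => 2 * g 0 ^+ 2 + 2 * C ^+ 2 * norm2 (X w) ^+ 2)).
- by apply: measurable_fun_lipschitz gC _ => // j; case: (X2 j).
- move=> w; have := gC (X w) 0; rewrite subr0 => h.
  have {}h : (g (X w) - g 0) ^+ 2 <= C ^+ 2 * norm2 (X w) ^+ 2.
    by rewrite -exprMn -real_normK ?num_real// ler_pXn2r ?nnegrE ?mulr_ge0 ?norm2_ge0// ltW.
  have := sqr_ge0 (g (X w) - 2 * g 0); lra.
- apply: integrableRD; first exact: integrableR_cst.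
  apply/integrableRZ/integrable_sqr_norm2 => i j; rewrite ord1; exact: X2.
Qed.

Lemma integrable_mxdot {m p} (M N : T -> 'M[R]_(m, p)) :
  entries (square_integrable P) M -> entries (square_integrable P) N ->
  integrableR P (fun w => mxdot (M w) (N w)).
Proof.
move=> hM hN; apply: integrableR_sum => i; apply: integrableR_sum => j.
exact: square_integrableM.
Qed.

Lemma Rintegral_sum (I : Type) (s : seq I) (f : I -> T -> R) :
  (forall i, integrableR P (f i)) ->
  \int[P]_w (\sum_(i <- s) f i w) = \sum_(i <- s) \int[P]_w f i w.
Proof.
move=> hf; elim: s => [|i s IH].
  under eq_Rintegral do rewrite big_nil.
  by rewrite big_nil Rintegral_cst// mul0r.
under eq_Rintegral do rewrite big_cons.
by rewrite big_cons RintegralD ?IH//; [exact: hf|exact: integrableR_sum].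
Qed.

(** Integrates a pointwise bound by a linear combination at once; the list pairs
    each coefficient with its random variable. *)
Lemma Rintegral_le_lincomb (f : T -> R) (s : seq (R * (T -> R))) :
  integrableR P f -> foldr (fun p h => integrableR P p.2 /\ h) True s ->
  (forall w, f w <= \sum_(p <- s) p.1 * p.2 w) ->
  \int[P]_w f w <= \sum_(p <- s) p.1 * \int[P]_w p.2 w.
Proof.
move=> hf hs fs.
suff [iS sE] : integrableR P (fun w => \sum_(p <- s) p.1 * p.2 w) /\
    \int[P]_w (\sum_(p <- s) p.1 * p.2 w) = \sum_(p <- s) p.1 * \int[P]_w p.2 w.
  by rewrite -sE; exact: le_Rintegral.
elim: s hs {fs} => [|[c g] s IH] /=.
  move=> _; split.
    by under eq_fun do rewrite big_nil; exact: integrableR_cst.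
  under eq_Rintegral do rewrite big_nil.
  by rewrite big_nil Rintegral_cst// mul0r.
move=> [ig /IH[iS sE]]; have icg := integrableRZ c ig; split.
  by under eq_fun do rewrite big_cons; exact: integrableRD.
under eq_Rintegral do rewrite big_cons.
by rewrite big_cons -sE RintegralD//= RintegralZl.
Qed.

End SquareIntegrableEntries.

Lemma measurable_without_closed {R : realType} {d} {T : measurableType d}
    (P : probability T R) (I : eqType) (X : I -> {RV P >-> R}) q :
  lipschitz_closed (measurable_without X q).
Proof. exact: measurable_lipschitz_closed. Qed.

(** * The noise model *)
Section NoiseIndependence.
Context {d : measure_display} {T : measurableType d} {R : realType}.
Variable P : probability T R.
Context {n r : nat} (sigma_eta sigma_xi : R).
Context (eta xi : nat -> 'I_n -> 'I_r -> {RV P >-> R}).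
Hypothesis hN : noise_model sigma_eta sigma_xi eta xi.

Notation X := (joint_entries eta xi).
Notation index := (bool * nat * 'I_n * 'I_r)%type.

Lemma joint_entry_square_integrable (q : index) : square_integrable P (X q).
Proof.
have aux (z : 'I_n -> 'I_r -> {RV P >-> R}) (s : R) i j :
    ('E_P[fun w => (norm2 (\matrix_(i, j) z i j w) ^+ 2)%R] <= s%:E)%E ->
    square_integrable P (z i j).
  move=> hE; have mz : measurable_fun setT (z i j) by exact: measurable_funP.
  have mn : measurable_fun setT (fun w => norm2 (\matrix_(i, j) z i j w) ^+ 2).
    apply: measurable_funX; apply: measurable_fun_norm2 => a b.
    by under eq_fun do rewrite mxE; exact: measurable_funP.
  apply: square_integrable_le mz _ _.
    by move=> w; have := sqr_entry_le (\matrix_(i, j) z i j w) i j; rewrite mxE; exact.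
  by apply: integrableR_ge0 hE => // w; exact: sqr_ge0.
case: hN => _ _ h1 h2; case: q => [[[b k] i] j]; case: b.
  exact: (aux (xi k) _ i j (h2 k)).
exact: (aux (eta k) _ i j (h1 k)).
Qed.

Lemma joint_entry_mean0 (q : index) : ('E_P[X q] = 0)%E.
Proof.
by case: hN => _ + _ _; case: q => [[[[] k] i] j] /(_ k i j)[].
Qed.

Lemma joint_entry_measurable (q q' : index) : q' != q ->
  measurable_without X q (X q').
Proof.
move=> qq' _ B mB; rewrite setTI.
by apply: sub_sigma_algebra; exact: cylinders_without_preimage.
Qed.

Lemma noise_mx_entries (Q : (T -> R) -> Prop) k (b : bool) :
  (forall i j, Q (X (b, k, i, j))) ->
  entries Q (noise_mx (if b then xi else eta) k).
Proof.
by move=> h i j; under eq_fun do rewrite mxE; case: b h => h; exact: h.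
Qed.

(** By linearity the integral is a combination of expectations of products of a
    centred noise entry with a variable measurable with respect to the other
    entries. *)
Lemma cross_term_eq0 {m} (A : T -> 'M[R]_(m, r)) (B : 'M[R]_(m, n)) b k :
  entries (square_integrable P) A ->
  (forall i j, entries (measurable_without X (b, k, i, j)) A) ->
  \int[P]_w mxdot (A w) (B *m noise_mx (if b then xi else eta) k w) = 0.
Proof.
move=> A2 mA; pose N := noise_mx (if b then xi else eta) k.
have N2 : entries (square_integrable P) N.
  by apply: noise_mx_entries => i j; exact: joint_entry_square_integrable.
have BN2 : entries (square_integrable P) (fun w => B *m N w).
  exact: (entries_mul (square_integrable_lipschitz_closed P) _ N2).
rewrite /mxdot Rintegral_sum => [|i]; last first.
  by apply: integrableR_sum => j; exact: square_integrableM.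
rewrite big1// => i _; rewrite Rintegral_sum => [|j]; last first.
  exact: square_integrableM.
rewrite big1// => j _.
rewrite (@eq_Rintegral _ _ _ _ _ (fun w => \sum_l B i l * (N w l j * A w i j))).
  rewrite Rintegral_sum => [|l]; last first.
    by apply: integrableRZ; exact: square_integrableM.
  rewrite big1// => l _; rewrite RintegralZl//; last exact: square_integrableM.
  rewrite [X in _ * X](_ : _ = 0) ?mulr0//.
  have X_indep : mutually_independent X by case: hN.
  have := @expectation_mul_independent _ _ _ _ _ _ X_indep (b, k, l, j)
    (fun w => A w i j) (mA l j i j) (joint_entry_square_integrable _) (A2 i j)
    (joint_entry_mean0 _).
  by apply: etrans; apply: eq_Rintegral => w _; rewrite mxE; case: b {mA N N2 BN2}.
by move=> w _; rewrite mxE mulr_sumr; apply: eq_bigr => l _; ring.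
Qed.

End NoiseIndependence.

(** * The stepsize condition *)
Section Stepsize.
Context {R : realType}.
Variables (n : nat) (mu L dI rw alpha : R).
Hypotheses (n_gt0 : (0 < n)%N) (mu_gt0 : 0 < mu) (L_gt0 : 0 < L).
Hypotheses (dI_ge1 : 1 <= dI) (rw_ge0 : 0 <= rw) (alpha_gt0 : 0 < alpha).
Hypothesis alpha_lt : alpha < stepsize_bound mu L dI rw.

Let dI_gt0 : 0 < dI. Proof. exact: lt_le_trans dI_ge1. Qed.

Let bounds : [/\ alpha < 1 / (mu + L),
  alpha < (1 - rw ^+ 2) / (4 * Num.sqrt 2 * dI * L) &
  alpha < Num.sqrt (2 * d_3 mu rw / (d_2 mu L dI rw +
     Num.sqrt (d_2 mu L dI rw ^+ 2 + 4 * d_1 mu L dI rw * d_3 mu rw)))].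
Proof. by move: alpha_lt; rewrite /stepsize_bound !lt_min => /and3P[]. Qed.

Lemma stepsize_mu : alpha * mu < 1.
Proof.
have [+ _ _] := bounds; rewrite ltr_pdivlMr ?addr_gt0//.
by have := mulr_gt0 alpha_gt0 L_gt0; lra.
Qed.

(** The second bound on the stepsize, cleared of its denominator. Its left-hand side
    is positive, and this is how the contraction factor of the network is seen to
    be smaller than 1. *)
Let scaled : alpha * (4 * Num.sqrt 2 * dI * L) < 1 - rw ^+ 2.
Proof.
have [_ + _] := bounds; rewrite ltr_pdivlMr// !mulr_gt0// sqrtr_gt0 ltr0n//.
Qed.

Lemma stepsize_gap : 0 < 1 - rw ^+ 2.
Proof.
by apply: lt_trans scaled; rewrite !mulr_gt0// sqrtr_gt0 ltr0n.
Qed.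

Lemma stepsize_L : 4 * (alpha * L) <= 1.
Proof.
have s2 : 1 <= Num.sqrt 2 :> R by rewrite -[leLHS]sqrtr1 ler_sqrt// ler1n.
have : 4 * (alpha * L) * 1 <= 4 * (alpha * L) * (Num.sqrt 2 * dI).
  apply: ler_wpM2l; first by rewrite mulr_ge0// mulr_ge0// ltW.
  by rewrite -[leLHS]mulr1 ler_pM.
have := sqr_ge0 rw; have := scaled; lra.
Qed.

Lemma stepsize_diagonal :
  16 * alpha ^+ 2 * L ^+ 2 * dI ^+ 2 / (1 - rw ^+ 2) < (1 - rw ^+ 2) / 2.
Proof.
have g0 := stepsize_gap; rewrite ltr_pdivrMr//.
have h : (alpha * (4 * Num.sqrt 2 * dI * L)) ^+ 2 < (1 - rw ^+ 2) ^+ 2.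
  by rewrite ltr_pXn2r ?nnegrE ?(ltW g0)// !mulr_ge0// ?sqrtr_ge0// ltW.
have s2 : Num.sqrt 2 ^+ 2 = 2 :> R by rewrite sqr_sqrtr.
have : (alpha * (4 * Num.sqrt 2 * dI * L)) ^+ 2 =
   16 * alpha ^+ 2 * dI ^+ 2 * L ^+ 2 * Num.sqrt 2 ^+ 2 by ring.
rewrite s2; lra.
Qed.

(** The third bound on alpha says that alpha^2 is smaller than the positive root of
    d_1 t^2 + d_2 t - d_3, written in its rationalized form
    2 d_3 / (d_2 + sqrt (d_2^2 + 4 d_1 d_3)). *)
Lemma stepsize_quadratic :
  d_1 mu L dI rw * alpha ^+ 4 + d_2 mu L dI rw * alpha ^+ 2 < d_3 mu rw.
Proof.
have g0 := stepsize_gap; have [_ _] := bounds.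
set d1 := d_1 _ _ _ _; set d2 := d_2 _ _ _ _; set d3 := d_3 _ _.
have d10 : 0 < d1.
  by rewrite divr_gt0 ?mulr_gt0 ?exprn_gt0.
have d20 : 0 < d2.
  by rewrite addr_gt0// ?divr_gt0 ?mulr_gt0 ?exprn_gt0.
have d30 : 0 < d3 by rewrite divr_gt0 ?mulr_gt0 ?exprn_gt0.
clearbody d1 d2 d3.
set D2 := d2 ^+ 2 + _; have D20 : 0 <= D2.
  by rewrite addr_ge0 ?sqr_ge0// mulr_ge0 ?(ltW d30)// mulr_ge0// ltW.
set D := Num.sqrt D2; have D0 : 0 <= D by exact: sqrtr_ge0.
have DE : D ^+ 2 = d2 ^+ 2 + 4 * d1 * d3 by rewrite sqr_sqrtr.
have dD : 0 < d2 + D by rewrite ltr_pwDl.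
have [e0 E] : 0 <= 2 * d3 / (d2 + D) /\ Num.sqrt (2 * d3 / (d2 + D)) ^+ 2 = 2 * d3 / (d2 + D).
  have e0 : 0 <= 2 * d3 / (d2 + D) by rewrite divr_ge0 ?mulr_ge0 ?ltW.
  by split => //; rewrite sqr_sqrtr.
move=> a_lt; have : alpha ^+ 2 < Num.sqrt (2 * d3 / (d2 + D)) ^+ 2.
  by rewrite ltr_pXn2r ?nnegrE ?sqrtr_ge0// ltW.
rewrite E ltr_pdivlMr//.
have -> : alpha ^+ 4 = (alpha ^+ 2) ^+ 2 by ring.
set t := alpha ^+ 2 => tD; have t0 : 0 < t by exact: exprn_gt0.
have Dd : 0 < D - d2.
  rewrite subr_gt0 -(@ltr_pXn2r _ 2) ?nnegrE ?(ltW d20)// DE ltrDl.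
  by rewrite !mulr_gt0.
(* Multiply by the conjugate: (D - d2) (D + d2) = 4 d1 d3. *)
have h1 : 2 * d1 * t + d2 < D.
  have : t * (d2 + D) * (D - d2) < 2 * d3 * (D - d2) by rewrite ltr_pM2r.
  have -> : t * (d2 + D) * (D - d2) = t * (D ^+ 2 - d2 ^+ 2) by ring.
  rewrite DE => h.
  have : (2 * d3) * (2 * d1 * t) < (2 * d3) * (D - d2) by lra.
  rewrite ltr_pM2l ?mulr_gt0//; lra.
have : (2 * d1 * t + d2) ^+ 2 < D ^+ 2.
  have p0 : 0 <= 2 * d1 * t + d2 by rewrite ltW// addr_gt0// !mulr_gt0.
  by rewrite ltr_pXn2r.
rewrite DE => h2.
have : (4 * d1) * (d1 * t ^+ 2 + d2 * t) < (4 * d1) * d3 by lra.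
by rewrite ltr_pM2l ?mulr_gt0.
Qed.

(** At 1 the characteristic polynomial of the rate matrix equals
    alpha (d_3 - d_2 alpha^2 - d_1 alpha^4): given the other two, the third stepsize
    bound is exactly the condition that the Perron root is smaller than 1. *)
Lemma rate_mx_perron :
  let A := rate_mx n mu L dI rw alpha in
  exists v : 'cV[R]_3, [/\ forall i, 0 < v i 0,
    A *m v = spectral_radius A *: v, 0 <= spectral_radius A &
    spectral_radius A < 1].
Proof.
have g0 := stepsize_gap; have am := stepsize_mu; have hd := stepsize_diagonal.
have hq := stepsize_quadratic.
have nR : 0 < n%:R :> R by rewrite ltr0n.
have q0 := sqr_ge0 rw.
have g1 : 0 < 1 - rw ^+ 2 by [].
have am0 := mulr_gt0 alpha_gt0 mu_gt0.
have k0 : 0 <= 16 * alpha ^+ 2 * L ^+ 2 * dI ^+ 2 / (1 - rw ^+ 2).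
  by rewrite divr_ge0 ?(ltW g0)// !mulr_ge0// ltW.
apply: cyclic_perron.
- by apply/andP; split; lra.
- by apply/andP; split; lra.
- by apply/andP; split; lra.
- by rewrite divr_gt0 ?mulr_gt0 ?exprn_gt0.
- by rewrite divr_gt0 ?mulr_gt0 ?exprn_gt0.
- by rewrite divr_gt0 ?mulr_gt0 ?exprn_gt0.
- by rewrite divr_ge0 ?(ltW g0)// !mulr_ge0// ltW.
rewrite -subr_gt0 in hq.
have := mulr_gt0 alpha_gt0 hq.
congr (_ < _); rewrite /d_1 /d_2 /d_3; field.
by rewrite !gt_eqF.
Qed.

Lemma rate_mx_ge0 i j : 0 <= rate_mx n mu L dI rw alpha i j.
Proof.
have g0 := stepsize_gap; have am := stepsize_mu; have q0 := sqr_ge0 rw.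
have nR : 0 < n%:R :> R by rewrite ltr0n.
have k0 : 0 <= 16 * alpha ^+ 2 * L ^+ 2 * dI ^+ 2 / (1 - rw ^+ 2).
  by rewrite divr_ge0 ?(ltW g0)// !mulr_ge0// ltW.
rewrite mxE; case: i => -[|[|[|//]]] ?; case: j => -[|[|[|//]]] ? //=;
  by [lra | rewrite divr_ge0 ?(ltW g0)// ?mulr_ge0// ltW].
Qed.

End Stepsize.

(** * The recursion of the expected errors *)
Lemma limn_esup_le_geometric {R : realType} (u : (\bar R)^nat) (th c q : R) :
  `|q| < 1 -> (forall k, u k <= (th + c * q ^+ k)%:E)%E ->
  (limn_esup u <= th%:E)%E.
Proof.
move=> q1 hu; apply/lee_addgt0Pr => e e0.
have /cvgrPdist_le/(_ e e0)[N _ HN] := cvg_geometric c q1.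
apply: le_trans (ereal_inf_lbound _) _.
  by exists [set k | (N <= k)%N]; [exists N|].
apply: ge_ereal_sup => _ [k /= Nk <-]; apply: le_trans (hu k) _.
rewrite -EFinD lee_fin lerD2l.
have := HN k Nk; rewrite /= sub0r normrN => /ler_normlP[_]; exact.
Qed.

Section ExpectedErrors.
Context {R : realType} {d : measure_display} {T : measurableType d}.
Variable P : probability T R.
Context {n r : nat} (n_ge2 : (2 <= n)%N).
Context (mu L : R) (mu_gt0 : 0 < mu) (L_gt0 : 0 < L).
Context (f : 'I_n -> 'rV[R]_r -> R).
Hypothesis hf : forall i, strongly_convex_smooth mu L (f i).
Context (xstar : 'rV[R]_r) (xstar_min : is_minimizer (mean_objective f) xstar).
Context (W : 'M[R]_n) (hW : coupling_mx W).
Context (sigma_eta sigma_xi : R).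
Context (eta xi : nat -> 'I_n -> 'I_r -> {RV P >-> R}).
Hypothesis hN : noise_model sigma_eta sigma_xi eta xi.
Context (s0 x0 : 'M[R]_(n, r)) (alpha : R) (alpha_gt0 : 0 < alpha).
Hypothesis alpha_lt : alpha < stepsize_bound mu L (d_I n) (rho_w W).

Notation rw := (rho_w W).
Notation ro := (spectral_radius (off_diag W)).
Notation dI := (d_I n).

Let it k w :=
  iterates f W alpha s0 x0 (noise_mx eta ^~ w) (noise_mx xi ^~ w) k.
Let S k w := (it k w).1.
Let X k w := (it k w).2.
Let Y k w := increment f W (S k w) (X k w) (noise_mx eta k w).

Let n_gt0 : (0 < n)%N. Proof. exact: leq_trans n_ge2. Qed.
Let rw_ge0 : 0 <= rw. Proof. exact: spectral_radius_ge0. Qed.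
Let dI_ge1 : 1 <= dI :> R. Proof. exact: d_I_ge1. Qed.
Let gap_gt0 : 0 < 1 - rw ^+ 2.
Proof. exact: stepsize_gap L_gt0 dI_ge1 alpha_gt0 alpha_lt. Qed.
Let alpha_mu : alpha * mu < 1.
Proof. exact: stepsize_mu mu_gt0 L_gt0 alpha_gt0 alpha_lt. Qed.
Let alpha_L : 4 * (alpha * L) <= 1.
Proof. exact: stepsize_L L_gt0 dI_ge1 alpha_gt0 alpha_lt. Qed.

Notation L2 := (entries (square_integrable P)).
Let cl := square_integrable_lipschitz_closed P.

Let eta_L2 k : L2 (noise_mx eta k).
Proof.
by apply: (noise_mx_entries (b := false)) => i j;
  exact: (joint_entry_square_integrable hN).
Qed.

Let xi_L2 k : L2 (noise_mx xi k).
Proof.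
by apply: (noise_mx_entries (b := true)) => i j;
  exact: (joint_entry_square_integrable hN).
Qed.

Let SX_L2 k : L2 (S k) /\ L2 (X k).
Proof. by apply: (entries_iterates cl L_gt0 hf) => l _; split. Qed.

Let Y_L2 k : L2 (Y k).
Proof.
by have [hS hX] := SX_L2 k; exact: (entries_increment cl L_gt0 hf W hS hX).
Qed.

Section Excluding.
Variable q : bool * nat * 'I_n * 'I_r.
Notation mq := (entries (measurable_without (joint_entries eta xi) q)).

Let clq := measurable_without_closed (joint_entries eta xi) q.

Lemma noise_excluding b k : (b, k) != (q.1.1.1, q.1.1.2) ->
  mq (noise_mx (if b then xi else eta) k).
Proof.
move=> bk; apply: noise_mx_entries => i j; apply: joint_entry_measurable.
by apply: contra bk => /eqP <-.
Qed.

(** Fixing one noise entry q, drawn at iteration k: everything computed before that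
    draw is a function of the other entries, hence independent of q. *)
Lemma iterates_excluding : mq (S q.1.1.2) /\ mq (X q.1.1.2).
Proof.
apply: (entries_iterates clq L_gt0 hf) => l lk; split.
  by apply: (@noise_excluding false); rewrite xpair_eqE (ltn_eqF lk) andbF.
by apply: (@noise_excluding true); rewrite xpair_eqE (ltn_eqF lk) andbF.
Qed.

(** The increment at iteration k already contains the noise of the tracker at that
    iteration, so this concerns only the entries of the noise of x. *)
Lemma increment_excluding : q.1.1.1 -> mq (Y q.1.1.2).
Proof.
move=> q1; have [hS hX] := iterates_excluding.
apply: (entries_increment clq L_gt0 hf W hS hX).
by apply: (@noise_excluding false); rewrite q1.
Qed.

End Excluding.

Definition opt_error k := \int[P]_w (norm2 (row_mean (X k w) - xstar) ^+ 2).
Definition consensus_error k := \int[P]_w (norm2 (deviation (X k w)) ^+ 2).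
Definition tracking_error k := \int[P]_w (norm2 (deviation (Y k w)) ^+ 2).

Lemma opt_error_integrable k :
  integrableR P (fun w => norm2 (row_mean (X k w) - xstar) ^+ 2).
Proof.
apply: integrable_sqr_norm2; have [_ hX] := SX_L2 k.
apply: (entriesB cl); first exact: (entries_row_mean cl).
exact: (entries_cst cl).
Qed.

Lemma consensus_error_integrable k :
  integrableR P (fun w => norm2 (deviation (X k w)) ^+ 2).
Proof.
apply: integrable_sqr_norm2; have [_ hX] := SX_L2 k.
exact: (entries_deviation cl).
Qed.

Lemma tracking_error_integrable k :
  integrableR P (fun w => norm2 (deviation (Y k w)) ^+ 2).
Proof. exact/integrable_sqr_norm2/(entries_deviation cl)/Y_L2. Qed.

Let eta_sq k := \int[P]_w (norm2 (noise_mx eta k w) ^+ 2).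
Let xi_sq k := \int[P]_w (norm2 (noise_mx xi k w) ^+ 2).

Let eta_int k : integrableR P (fun w => norm2 (noise_mx eta k w) ^+ 2).
Proof. exact: integrable_sqr_norm2. Qed.

Let xi_int k : integrableR P (fun w => norm2 (noise_mx xi k w) ^+ 2).
Proof. exact: integrable_sqr_norm2. Qed.

Let eta_sq_le k : eta_sq k <= sigma_eta ^+ 2.
Proof.
by rewrite -lee_fin -expectation_Rintegral//; case: hN.
Qed.

Let xi_sq_le k : xi_sq k <= sigma_xi ^+ 2.
Proof.
by rewrite -lee_fin -expectation_Rintegral//; case: hN.
Qed.

Lemma opt_error_step k :
  opt_error k.+1 <= (1 - alpha * mu) * opt_error k +
    2 * alpha * L ^+ 2 / (mu * n%:R) * consensus_error k +
    ro ^+ 2 * (alpha ^+ 2 * sigma_eta ^+ 2 + sigma_xi ^+ 2).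
Proof.
have [_ hX] := SX_L2 k.
pose p w := descent_target f xstar alpha (X k w).
have p_entries (Q : (T -> R) -> Prop) : lipschitz_closed Q ->
    entries Q (X k) -> entries Q p.
  move=> Qcl hQ; apply: (entriesB Qcl); last exact: (entries_cst Qcl).
  apply: (entriesB Qcl); first exact: (entries_row_mean Qcl).
  apply/(entriesZ Qcl)/(entries_row_mean Qcl).
  exact: (entries_stacked_grad Qcl L_gt0 hf).
pose Q : 'M[R]_(1, n) := n%:R^-1 *: (ones^T *m off_diag W).
have QE (N : 'M[R]_(n, r)) : row_mean (off_diag W *m N) = Q *m N.
  by rewrite /row_mean /Q -scalemxAl mulmxA.
have p_L2 : L2 p by exact: (p_entries _ cl).
have p_excl b i j := p_entries _ (measurable_without_closed _ _)
  (iterates_excluding (b, k, i, j)).2.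
have cross b : integrableR P
    (fun w => mxdot (p w) (Q *m noise_mx (if b then xi else eta) k w)).
  apply: integrable_mxdot => //; apply: (entries_mul cl).
  by case: b.
apply: le_trans (@Rintegral_le_lincomb _ _ _ P _
  [:: (1 - alpha * mu, fun w => norm2 (row_mean (X k w) - xstar) ^+ 2);
      (2 * alpha * L ^+ 2 / (mu * n%:R), fun w => norm2 (deviation (X k w)) ^+ 2);
      (ro ^+ 2, fun w => norm2 (noise_mx xi k w) ^+ 2);
      (ro ^+ 2 * alpha ^+ 2, fun w => norm2 (noise_mx eta k w) ^+ 2);
      (2, fun w => mxdot (p w) (Q *m noise_mx xi k w));
      (- (2 * alpha), fun w => mxdot (p w) (Q *m noise_mx eta k w))]
  (opt_error_integrable k.+1) _ _) _.
- do ![split]; [exact: opt_error_integrable|exact: consensus_error_integrable|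
    exact: xi_int|exact: eta_int|exact: (cross true)|exact: (cross false)].
- move=> w; rewrite !big_cons big_nil /= -!QE {1}/X /it iteratesS /=.
  have := optimality_step n_ge2 mu_gt0 L_gt0 hf xstar_min hW alpha_gt0 alpha_mu
    alpha_L (S k w) (X k w) (noise_mx eta k w) (noise_mx xi k w).
  rewrite -/(X k w) -/(S k w) -/(p w); lra.
rewrite !big_cons big_nil /=.
rewrite (@cross_term_eq0 _ _ _ P _ _ _ _ _ _ hN _ _ _ true)//.
rewrite (@cross_term_eq0 _ _ _ P _ _ _ _ _ _ hN _ _ _ false)//.
rewrite -/(opt_error k) -/(consensus_error k) -/(xi_sq k) -/(eta_sq k).
have h1 := ler_wpM2l (sqr_ge0 ro) (xi_sq_le k).
have h2 := ler_wpM2l (mulr_ge0 (sqr_ge0 ro) (sqr_ge0 alpha)) (eta_sq_le k).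
lra.
Qed.

Lemma consensus_error_step k :
  consensus_error k.+1 <= (1 + rw ^+ 2) / 2 * consensus_error k +
    2 * alpha ^+ 2 / (1 - rw ^+ 2) * tracking_error k +
    ro ^+ 2 * sigma_xi ^+ 2.
Proof.
have [_ hX] := SX_L2 k.
pose D w := (W - averaging_mx) *m deviation (X k w) - alpha *: deviation (Y k w).
have D_entries (Q : (T -> R) -> Prop) : lipschitz_closed Q ->
    entries Q (X k) -> entries Q (Y k) -> entries Q D.
  move=> Qcl hQX hQY; apply: (entriesB Qcl).
    exact/(entries_mul Qcl)/(entries_deviation Qcl).
  exact/(entriesZ Qcl)/(entries_deviation Qcl).
pose Q : 'M[R]_n := (1%:M - averaging_mx) *m off_diag W.
have QE (N : 'M[R]_(n, r)) : deviation (off_diag W *m N) = Q *m N.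
  by rewrite /deviation -averaging_mul /Q -mulmxA mulmxBl mul1mx.
have D_L2 : L2 D by exact: (D_entries _ cl).
have D_excl i j := D_entries _ (measurable_without_closed _ _)
  (iterates_excluding (true, k, i, j)).2
  (@increment_excluding (true, k, i, j) isT).
have cross : integrableR P (fun w => mxdot (D w) (Q *m noise_mx xi k w)).
  by apply: integrable_mxdot => //; exact: (entries_mul cl).
apply: le_trans (@Rintegral_le_lincomb _ _ _ P _
  [:: ((1 + rw ^+ 2) / 2, fun w => norm2 (deviation (X k w)) ^+ 2);
      (2 * alpha ^+ 2 / (1 - rw ^+ 2), fun w => norm2 (deviation (Y k w)) ^+ 2);
      (ro ^+ 2, fun w => norm2 (noise_mx xi k w) ^+ 2);
      (2, fun w => mxdot (D w) (Q *m noise_mx xi k w))]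
  (consensus_error_integrable k.+1) _ _) _.
- by do ![split]; [exact: consensus_error_integrable |
    exact: tracking_error_integrable|exact: xi_int|exact: cross].
- move=> w; rewrite !big_cons big_nil /= -!QE {1}/X /it iteratesS /=.
  have := consensus_step n_ge2 f hW alpha gap_gt0
    (S k w) (X k w) (noise_mx eta k w) (noise_mx xi k w).
  rewrite -/(X k w) -/(S k w) -/(Y k w) -/(D w); lra.
rewrite !big_cons big_nil /=.
rewrite (@cross_term_eq0 _ _ _ P _ _ _ _ _ _ hN _ _ _ true)//.
rewrite -/(consensus_error k) -/(tracking_error k) -/(xi_sq k).
have h1 := ler_wpM2l (sqr_ge0 ro) (xi_sq_le k).
lra.
Qed.

Lemma tracking_error_step k :
  tracking_error k.+1 <=
    32 * n%:R * alpha ^+ 2 * L ^+ 4 / (1 - rw ^+ 2) * opt_error k +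
    64 * L ^+ 2 / (1 - rw ^+ 2) * consensus_error k +
    ((1 + rw ^+ 2) / 2 + 16 * alpha ^+ 2 * L ^+ 2 / (1 - rw ^+ 2)) *
      tracking_error k +
    ro ^+ 2 / (1 - rw ^+ 2) *
      (17 * sigma_eta ^+ 2 + 4 * L ^+ 2 * sigma_xi ^+ 2).
Proof.
have [_ hX] := SX_L2 k.
pose D w := W *m X k w - X k w - alpha *: Y k w.
have D_entries (Q : (T -> R) -> Prop) : lipschitz_closed Q ->
    entries Q (X k) -> entries Q (Y k) -> entries Q D.
  move=> Qcl hQX hQY; apply: (entriesB Qcl); last exact: (entriesZ Qcl).
  by apply: (entriesB Qcl) => //; exact: (entries_mul Qcl).
have D_L2 : L2 D by exact: (D_entries _ cl).
have D_excl i j := D_entries _ (measurable_without_closed _ _)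
  (iterates_excluding (true, k, i, j)).2
  (@increment_excluding (true, k, i, j) isT).
have cross : integrableR P (fun w => mxdot (D w) (off_diag W *m noise_mx xi k w)).
  by apply: integrable_mxdot => //; exact: (entries_mul cl).
pose c := ro ^+ 2 / (1 - rw ^+ 2).
apply: le_trans (@Rintegral_le_lincomb _ _ _ P _
  [:: (32 * n%:R * alpha ^+ 2 * L ^+ 4 / (1 - rw ^+ 2),
         fun w => norm2 (row_mean (X k w) - xstar) ^+ 2);
      (64 * L ^+ 2 / (1 - rw ^+ 2), fun w => norm2 (deviation (X k w)) ^+ 2);
      ((1 + rw ^+ 2) / 2 + 16 * alpha ^+ 2 * L ^+ 2 / (1 - rw ^+ 2),
         fun w => norm2 (deviation (Y k w)) ^+ 2);
      (c * 8, fun w => norm2 (noise_mx eta k.+1 w) ^+ 2);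
      (c * 9, fun w => norm2 (noise_mx eta k w) ^+ 2);
      (c * (4 * L ^+ 2), fun w => norm2 (noise_mx xi k w) ^+ 2);
      (8 * L ^+ 2 / (1 - rw ^+ 2),
         fun w => mxdot (D w) (off_diag W *m noise_mx xi k w))]
  (tracking_error_integrable k.+1) _ _) _.
- by do ![split]; [exact: opt_error_integrable |
    exact: consensus_error_integrable | exact: tracking_error_integrable |
    exact: eta_int | exact: eta_int | exact: xi_int | exact: cross].
- move=> w; rewrite !big_cons big_nil /=.
  have -> : Y k.+1 w = increment f W (S k w + Y k w)
      (next_point f W alpha (S k w) (X k w) (noise_mx eta k w) (noise_mx xi k w))
      (noise_mx eta k.+1 w).
    by rewrite {1}/Y /S /X /it iteratesS.
  have := tracking_step n_ge2 L_gt0 hf xstar_min hW alpha_gt0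
    alpha_L gap_gt0 (S k w) (X k w) (noise_mx eta k w) (noise_mx xi k w)
    (noise_mx eta k.+1 w).
  rewrite -/(Y k w) -/(D w) -/c; lra.
rewrite !big_cons big_nil /=.
rewrite (@cross_term_eq0 _ _ _ P _ _ _ _ _ _ hN _ _ _ true)//.
rewrite -/(opt_error k) -/(consensus_error k) -/(tracking_error k).
rewrite -/(xi_sq k) -/(eta_sq k) -/(eta_sq k.+1) -/c.
have c0 : 0 <= c by rewrite divr_ge0 ?sqr_ge0// ltW.
have h1 := ler_wpM2l c0 (eta_sq_le k).
have h2 := ler_wpM2l c0 (eta_sq_le k.+1).
have h3 := ler_wpM2l (mulr_ge0 c0 (sqr_ge0 L)) (xi_sq_le k).
lra.
Qed.

Definition error_vec k : 'cV[R]_3 :=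
  mx_of_rows [:: [:: opt_error k]; [:: consensus_error k]; [:: tracking_error k]].

(** The one-step bounds have smaller constants than the rate matrix and the noise
    vector; the difference consists of nonnegative multiples of d_I^2 - 1 and
    n d_I^2 - 1. *)
Lemma error_vec_step k i :
  error_vec k.+1 i 0 <=
  (rate_mx n mu L dI rw alpha *m error_vec k +
   noise_vec n L dI rw alpha sigma_eta sigma_xi ro) i 0.
Proof.
have u0 : 0 <= opt_error k by apply: Rintegral_ge0 => w _; exact: sqr_ge0.
have v0 : 0 <= consensus_error k by apply: Rintegral_ge0 => w _; exact: sqr_ge0.
have z0 : 0 <= tracking_error k by apply: Rintegral_ge0 => w _; exact: sqr_ge0.
have h1 := opt_error_step k; have h2 := consensus_error_step k.
have h3 := tracking_error_step k.
have dI2 : 1 <= dI ^+ 2 :> R by rewrite exprn_ege1.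
have n1 : 1 <= n%:R :> R by rewrite ler1n.
have nd : 1 <= n%:R * dI ^+ 2 :> R by rewrite -[leLHS]mulr1 ler_pM.
have g0 : 0 <= (1 - rw ^+ 2)^-1 by rewrite invr_ge0 ltW.
have r0 := sqr_ge0 ro.
rewrite !mxE !big_ord_recl big_ord0 !mxE /=.
case: i => -[|[|[|//]]] ? /=.
- by apply: le_trans h1 _; rewrite le_eqVlt; apply/orP; left; apply/eqP; ring.
- apply: le_trans h2 _; rewrite -subr_ge0.
  have : 0 <= ro ^+ 2 * sigma_xi ^+ 2 * (n%:R * dI ^+ 2 - 1).
    by rewrite mulr_ge0 ?subr_ge0// mulr_ge0// sqr_ge0.
  by congr (0 <= _); ring.
apply: le_trans h3 _; rewrite -subr_ge0.
have dI2' : 0 <= dI ^+ 2 - 1 :> R by rewrite subr_ge0.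
have nd' : 0 <= n%:R * dI ^+ 2 - 1 :> R by rewrite subr_ge0.
have L4 : 0 <= L ^+ 4 by rewrite exprn_ge0// ltW.
have aL : 0 <= alpha ^+ 2 * L ^+ 2 by rewrite mulr_ge0 ?sqr_ge0.
have e1 := mulr_ge0 dI2' (mulr_ge0 (mulr_ge0 (mulr_ge0 (ler0n R (32 * n))
  (mulr_ge0 (sqr_ge0 alpha) L4)) g0) u0).
have e2 := mulr_ge0 dI2' (mulr_ge0 (mulr_ge0 (mulr_ge0 (ler0n R 64)
  (sqr_ge0 L)) g0) v0).
have e3 := mulr_ge0 dI2' (mulr_ge0 (mulr_ge0 (mulr_ge0 (ler0n R 16) aL) g0) z0).
have c0 := mulr_ge0 r0 g0.
have e4 := mulr_ge0 nd' (mulr_ge0 c0 (addr_ge0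
  (mulr_ge0 (ler0n R 24) (sqr_ge0 sigma_eta))
  (mulr_ge0 (mulr_ge0 (ler0n R 4) (sqr_ge0 L)) (sqr_ge0 sigma_xi)))).
have e5 := mulr_ge0 (ler0n R 7) (mulr_ge0 c0 (sqr_ge0 sigma_eta)).
have := addr_ge0 (addr_ge0 (addr_ge0 (addr_ge0 e1 e2) e3) e4) e5.
by rewrite natrM; congr (0 <= _); ring.
Qed.

Lemma expected_errors_bound (A := rate_mx n mu L dI rw alpha)
    (th := invmx (1%:M - A) *m noise_vec n L dI rw alpha sigma_eta sigma_xi ro) :
  [/\ 0 <= spectral_radius A, spectral_radius A < 1 &
    exists c, forall k,
      opt_error k <= th 0 0 + c * spectral_radius A ^+ k /\
      consensus_error k <= th 1 0 + c * spectral_radius A ^+ k].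
Proof.
have [v [v0 Av rho0 rho1]] := rate_mx_perron n_gt0 mu_gt0 L_gt0 dI_ge1
  alpha_gt0 alpha_lt.
have Ainv : 1%:M - A \in unitmx by exact: unitmx_sub_spectral.
have thE : A *m th + noise_vec n L dI rw alpha sigma_eta sigma_xi ro = th.
  by rewrite -[X in _ + X](mulKVmx Ainv) -/th mulmxBl mul1mx addrC subrK.
have [c hc] := positive_recursion
  (rate_mx_ge0 n_gt0 mu_gt0 L_gt0 dI_ge1 alpha_gt0 alpha_lt)
  v0 Av thE error_vec_step.
split=> //; exists (Num.max (c * v 0 0) (c * v 1 0)) => k.
have rk : 0 <= spectral_radius A ^+ k by rewrite exprn_ge0.
have h1 := hc k 0; have h2 := hc k 1.
rewrite [error_vec k 0 0]mxE /= in h1; rewrite [error_vec k 1 0]mxE /= in h2.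
split; [apply: le_trans h1 _ | apply: le_trans h2 _];
  by rewrite lerD2l mulrAC ler_wpM2r// le_max lexx ?orbT.
Qed.

End ExpectedErrors.

Theorem theorem3 (R : realType) (d : measure_display) (T : measurableType d)
    (P : probability T R) (n r : nat) (hn : (2 <= n)%N)
    (mu L : R) (mu_gt0 : 0 < mu) (L_gt0 : 0 < L)
    (f : 'I_n -> 'rV[R]_r -> R)
    (hF : forall i, strongly_convex_smooth mu L (f i))
    (xstar : 'rV[R]_r) (hxstar : is_minimizer (mean_objective f) xstar)
    (W : 'M[R]_n) (hW : coupling_mx W)
    (sigma_eta sigma_xi : R)
    (sigma_eta_gt0 : 0 < sigma_eta) (sigma_xi_gt0 : 0 < sigma_xi)
    (eta xi : nat -> 'I_n -> 'I_r -> {RV P >-> R})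
    (hN : noise_model sigma_eta sigma_xi eta xi)
    (s0 x0 : 'M[R]_(n, r))
    (alpha : R) (alpha_gt0 : 0 < alpha)
    (halpha : alpha < stepsize_bound mu L (d_I n) (rho_w W)) :
  let x (k : nat) (w : T) : 'M[R]_(n, r) :=
    (iterates f W alpha s0 x0 (noise_mx eta ^~ w) (noise_mx xi ^~ w) k).2 in
  let opt_err (k : nat) : \bar R :=
    'E_P[fun w => (norm2 (row_mean (x k w) - xstar) ^+ 2)%R]%E in
  let cons_err (k : nat) : \bar R :=
    'E_P[fun w => (norm2 (x k w - ones *m row_mean (x k w)) ^+ 2)%R]%E in
  let A : 'M[R]_3 := rate_mx n mu L (d_I n) (rho_w W) alpha in
  let B : 'cV[R]_3 := noise_vec n L (d_I n) (rho_w W) alpha sigma_eta sigma_xi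
                        (spectral_radius (off_diag W)) in
  let theta : 'cV[R]_3 := invmx (1%:M - A) *m B in
  let theta1 : R := theta 0 0 in
  let theta2 : R := theta 1 0 in
  [/\ spectral_radius A < 1,
      exists c : R, forall k : nat,
        (opt_err k <= (theta1 + c * spectral_radius A ^+ k)%:E)%E /\
        (cons_err k <= (theta2 + c * spectral_radius A ^+ k)%:E)%E,
      (limn_esup opt_err <= theta1%:E)%E
    & (limn_esup cons_err <= theta2%:E)%E].
Proof.
move=> x opt_err cons_err A B theta theta1 theta2.
have [rho0 rho1 [c hc]] := expected_errors_bound hn mu_gt0 L_gt0 hF hxstar hW hN
  s0 x0 alpha_gt0 halpha.
have optE k : opt_err k = (opt_error f xstar W eta xi s0 x0 alpha k)%:E.
  exact/expectation_Rintegral/(opt_error_integrable L_gt0 hF _ _ hN).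
have consE k : cons_err k = (consensus_error f W eta xi s0 x0 alpha k)%:E.
  exact/expectation_Rintegral/(consensus_error_integrable L_gt0 hF _ hN).
have opt_le k : (opt_err k <= (theta1 + c * spectral_radius A ^+ k)%:E)%E.
  by rewrite optE lee_fin; case: (hc k).
have cons_le k : (cons_err k <= (theta2 + c * spectral_radius A ^+ k)%:E)%E.
  by rewrite consE lee_fin; case: (hc k).
have rho_lt1 : `|spectral_radius A| < 1 by rewrite ger0_norm.
split=> //; first by exists c.
- exact: limn_esup_le_geometric rho_lt1 opt_le.
- exact: limn_esup_le_geometric rho_lt1 cons_le.
Qed.
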